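(* For $0<t<1$ define the marginal exponent profiles $$M_x(t)=\int_E t^{-\alpha_1}\,d\mu(\alpha),\qquad M_y(t)=\int_E t^{-\alpha_2}\,d\mu(\alpha).$$ Whenever $\int_0^\varepsilon\sqrt{M_x(t)}\,dt<\infty$ and $\int_0^\varepsilon\sqrt{M_y(t)}\,dt<\infty$, put $$\Xi_x(x)=\int_0^x\sqrt{M_x(t)}\,dt,\qquad \Xi_y(y)=\int_0^y\sqrt{M_y(t)}\,dt.$$ Then $\Xi_x$ and $\Xi_y$, viewed as functions on $U_B$, are uniformly Lipschitz with respect to $d_\mu$; more precisely, for every tangent vector $v$ at every point of $U_B$, $$|d\Xi_x(v)|\le\frac1{\sqrt{c_0c_u}}|v|_{g_\mu},\qquad |d\Xi_y(v)|\le\frac1{\sqrt{c_0c_u}}|v|_{g_\mu}.$$ Hence both functions extend uniquely and continuously to the metric completion of $(U_B,d_\mu)$. If $A_\mu\le2$ and $\int^\infty\sqrt{\mathcal T_\mu(S)}\,dS<\infty$, then the two marginal integrability conditions above hold automatically, and in this regime the extensions of $\Xi_x$ and $\Xi_y$ vanish simultaneously at a point of the completion if and only if that point lies over the Euclidean corner stratum, i.e. its Euclidean limit has $x=y=0$.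
   Context: Let $k\ge0$, let $V\subset\mathbb R^k$ be open, let $0<\varepsilon<1$, and let $U=[0,\varepsilon)^2\times V$ with coordinates $(x,y,z)$ (an adapted chart of a manifold with corners near the codimension-two corner stratum $\{x=y=0\}$), with $U^\circ=(0,\varepsilon)^2\times V$. Let $g_{\mathrm E}$ be the Euclidean metric and $g_0$ a smooth Riemannian metric on $U$ with $c_0g_{\mathrm E}\le g_0\le C_0g_{\mathrm E}$ for constants $0<c_0\le C_0<\infty$. Let $\mu$ be a finite nonzero positive Radon measure with compact support $E=\operatorname{supp}\mu\subset\mathbb R_{\ge0}^2$. Let $u:E\times U^\circ\to(0,\infty)$ be jointly measurable with $0<c_u\le u(\alpha;x,y,z)\le C_u<\infty$ for $\mu$-almost every $\alpha\in E$ and every $(x,y,z)\in U^\circ$, and assume that $F_\mu(x,y,z)=\int_E u(\alpha;x,y,z)x^{-\alpha_1}y^{-\alpha_2}\,d\mu(\alpha)$ is continuous and positive on $U^\circ$. Put $g_\mu=F_\mu g_0$. Fix a Euclidean ball $B$ relatively compact in $V$, and let $U_B=(0,\varepsilon)^2\times B$. Let $d_\mu$ be the intrinsic distance on $U_B$: the infimum of $g_\mu$-lengths of absolutely continuous curves contained in $U_B$. Every $d_\mu$-Cauchy sequence in $U_B$ has a unique Euclidean limit in $[0,\varepsilon]^2\times\overline B$, so every completion point has a well-defined Euclidean limit. Put $A_\mu=\max_{\alpha\in E}(\alpha_1+\alpha_2)$ and $\mathcal T_\mu(S)=\int_E e^{-S(2-\alpha_1-\alpha_2)}\,d\mu(\alpha)$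 for $S\ge0$. The notation $\int^\infty$ means the integral over $[S_0,\infty)$ for some (equivalently any) $S_0\ge0$. *)

(* Defs.v *)
From HB Require Import structures.
From mathcomp Require Import all_boot all_order all_algebra.
From mathcomp Require Import all_classical all_reals all_analysis.

Set Implicit Arguments.
Unset Strict Implicit.
Unset Printing Implicit Defensive.

Import Order.TTheory GRing.Theory Num.Theory.
Import numFieldNormedType.Exports.

Local Open Scope classical_set_scope.
Local Open Scope ring_scope.

Section Euclidean.
Context {R : realType} {n : nat}.

Definition qform (G : 'M[R]_n) (v : 'rV[R]_n) : R := (v *m G *m v^T) 0 0.

(* The library's norm on row vectors is the sup norm; only its topology, which
   is the Euclidean one, is used below. *)
Definition enorm (v : 'rV[R]_n) : R := Num.sqrt (qform 1%:M v).

Definition eball (c : 'rV[R]_n) (r : R) : set 'rV[R]_n :=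
  [set z | enorm (z - c) < r].

End Euclidean.

Section Smoothness.
Context {R : realType} {n : nat}.

(* f is of class C^m on the open set W *)
Fixpoint Cn_on (m : nat) (W : set 'rV[R]_n) (f : 'rV[R]_n -> R) : Prop :=
  (forall p, W p -> {for p, continuous f}) /\
  match m with
  | 0%N => True
  | m'.+1 => forall i : 'I_n,
      (forall p, W p -> derivable f p (delta_mx 0 i)) /\
      Cn_on m' W (fun p => 'D_(delta_mx 0 i) f p)
  end.

(* Smoothness on a set that need not be open, such as a chart with corners:
   near each point, f is the restriction of a smooth function. *)
Definition smooth_on (U : set 'rV[R]_n) (f : 'rV[R]_n -> R) : Prop :=
  forall p, U p -> exists W : set 'rV[R]_n, exists h : 'rV[R]_n -> R,
    [/\ open W, W p, forall m, Cn_on m W h &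
        forall q, W q -> U q -> h q = f q].

Definition riemannian_metric (U : set 'rV[R]_n) (g : 'rV[R]_n -> 'M[R]_n) :=
  [/\ forall i j, smooth_on U (fun p => g p i j),
      forall p, U p -> (g p)^T = g p &
      forall p v, U p -> v != 0 -> 0 < qform (g p) v].

End Smoothness.

Section Length.
Context {R : realType} {n : nat}.

Definition abs_continuous (a b : R) (c : R -> 'rV[R]_n) : Prop :=
  forall e, 0 < e -> exists2 d, 0 < d &
    forall (m : nat) (s t : 'I_m -> R),
      (forall i, a <= s i /\ s i <= t i /\ t i <= b) ->
      (forall i j, i != j -> t i <= s j \/ t j <= s i) ->
      \sum_(i < m) (t i - s i) < d ->
      \sum_(i < m) enorm (c (t i) - c (s i)) < e.

Definition metric_norm (g : 'rV[R]_n -> 'M[R]_n) (p v : 'rV[R]_n) : R :=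
  Num.sqrt (qform (g p) v).

(* An absolutely continuous curve is differentiable almost everywhere. *)
Definition curve_length (g : 'rV[R]_n -> 'M[R]_n) (c : R -> 'rV[R]_n) : \bar R :=
  \int[@lebesgue_measure R]_(t in `[0, 1]) (metric_norm g (c t) (derive1 c t))%:E.

Definition curve_between (A : set 'rV[R]_n) (p q : 'rV[R]_n)
    (c : R -> 'rV[R]_n) : Prop :=
  [/\ abs_continuous 0 1 c, forall t, 0 <= t <= 1 -> A (c t), c 0 = p & c 1 = q].

Definition intrinsic_dist (A : set 'rV[R]_n) (g : 'rV[R]_n -> 'M[R]_n)
    (p q : 'rV[R]_n) : \bar R :=
  ereal_inf [set curve_length g c | c in curve_between A p q].

End Length.

Section Completion.
Context {R : realType} {n : nat}.

Definition complete_space (X : metricType R) : Prop :=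
  forall F : set_system X, ProperFilter F -> cauchy F -> exists l : X, F --> l.

(* (X, i) is a metric completion of (A, d); i is only relevant on A. *)
Definition is_completion (A : set 'rV[R]_n) (d : 'rV[R]_n -> 'rV[R]_n -> \bar R)
    (X : metricType R) (i : 'rV[R]_n -> X) : Prop :=
  [/\ complete_space X,
      forall p q, A p -> A q -> (mdist (i p) (i q))%:E = d p q &
      dense (i @` A)].

Definition continuous_extension (A : set 'rV[R]_n) (X : metricType R)
    (i : 'rV[R]_n -> X) (f : 'rV[R]_n -> R) (h : X -> R) : Prop :=
  continuous h /\ forall p, A p -> h (i p) = f p.

Definition euclidean_limit (A : set 'rV[R]_n) (X : metricType R)
    (i : 'rV[R]_n -> X) (xi : X) (p : 'rV[R]_n) : Prop :=
  forall s : nat -> 'rV[R]_n, (forall m, A (s m)) ->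
    i (s m) @[m --> \oo] --> xi -> s m @[m --> \oo] --> p.

End Completion.

Section Chart.
Context {R : realType} {k : nat}.

Definition cx (p : 'rV[R]_(2 + k)) : R := lsubmx p 0 0.
Definition cy (p : 'rV[R]_(2 + k)) : R := lsubmx p 0 1.
Definition cz (p : 'rV[R]_(2 + k)) : 'rV[R]_k := rsubmx p.

Definition chart (eps : R) (V : set 'rV[R]_k) : set 'rV[R]_(2 + k) :=
  [set p | [/\ 0 <= cx p < eps, 0 <= cy p < eps & V (cz p)]].

Definition chart_int (eps : R) (V : set 'rV[R]_k) : set 'rV[R]_(2 + k) :=
  [set p | [/\ 0 < cx p < eps, 0 < cy p < eps & V (cz p)]].

Definition over_corner (A : set 'rV[R]_(2 + k)) (X : metricType R)
    (i : 'rV[R]_(2 + k) -> X) (xi : X) : Prop :=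
  exists p, [/\ euclidean_limit A i xi p, cx p = 0 & cy p = 0].

End Chart.

(* The plane of exponents, with its Borel sigma-algebra. Every finite Borel
   measure on it is a Radon measure. *)
Notation exponents R := (measurableTypeR R * measurableTypeR R)%type.

(* measurability on E `*` U for the product of the Borel sigma-algebras *)
Definition jointly_measurable {R : realType} {n : nat}
    (E : set (R * R)) (U : set 'rV[R]_n) (u : R * R -> 'rV[R]_n -> R) : Prop :=
  @measurable_fun _ _ (exponents R * g_sigma_algebraType (@open 'rV[R]_n))%type
    (measurableTypeR R) (E `*` U) (fun w => u w.1 w.2).

Section Profiles.
Context {R : realType}.
Variable mu : {finite_measure set (exponents R) -> \bar R}.

Definition msupport : set (R * R) :=
  [set a | forall O : set (R * R), open O -> O a -> (0 < mu O)%E].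

Definition conformal_factor (k : nat) (u : R * R -> 'rV[R]_(2 + k) -> R)
    (p : 'rV[R]_(2 + k)) : R :=
  \int[mu]_(a in msupport) (u a p * cx p `^ (- a.1) * cy p `^ (- a.2)).

(* a maximum whenever the support is compact and nonempty *)
Definition max_weight : R := sup [set a.1 + a.2 | a in msupport].

Definition laplace_profile (S : R) : R :=
  \int[mu]_(a in msupport) expR (- (S * (2 - a.1 - a.2))).

Definition profile_x (t : R) : R := \int[mu]_(a in msupport) t `^ (- a.1).
Definition profile_y (t : R) : R := \int[mu]_(a in msupport) t `^ (- a.2).

End Profiles.

Section Primitives.
Context {R : realType}.

Definition sqrt_integrable (D : set R) (M : R -> R) : Prop :=
  (\int[@lebesgue_measure R]_(t in D) (Num.sqrt (M t))%:E < +oo)%E.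

Definition sqrt_primitive (M : R -> R) (x : R) : R :=
  \int[@lebesgue_measure R]_(t in `]0, x]) Num.sqrt (M t).

End Primitives.

(* Main.v *)
Require Import Defs.
From HB Require Import structures.
From mathcomp Require Import all_boot all_order all_algebra.
From mathcomp Require Import all_classical all_reals all_analysis.
From mathcomp Require Import measurable_realfun ring lra.

Set Implicit Arguments.
Unset Strict Implicit.
Unset Printing Implicit Defensive.

Import Order.TTheory GRing.Theory Num.Theory.
Import numFieldNormedType.Exports.

Local Open Scope classical_set_scope.
Local Open Scope ring_scope.

(* The bounds F >= cu * M_x and g0 >= c0 * g_E give
   |dXi_x(v)| = sqrt(M_x) |v_x| <= |v|_g / sqrt(c0 cu) at once.  To integrate this
   along an absolutely continuous curve one needs that such a curve is
   differentiable almost everywhere and is the integral of its derivative; this is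
   obtained from the total variation, the Radon-Nikodym theorem applied to a
   Lebesgue-Stieltjes measure, and the Lebesgue differentiation theorem.  The same
   argument applied to the coordinates, with F >= cu * mu(E), shows that they are
   Lipschitz for d_mu, so they extend to the completion, and their extensions are
   the Euclidean limit.  As sqrt(mu(E)) x <= Xi_x(x) and Xi_x(x) -> 0 as x -> 0,
   the extension of Xi_x vanishes exactly where that of x does.  Finally, t = e^-S
   turns sqrt(M_x(t)) dt into sqrt(M_x(e^-S) e^-2S) dS <= sqrt(T(S)) dS. *)

(** * Absolutely continuous functions *)

(** The bound [F >= cu * M_x] comes from discarding the factor [y^(-a.2)], which is at least 1
    because exponents in the support are nonnegative and [y < eps < 1]. Three obstacles shape the
    rest. The slope [sqrt (M_x x)] may blow up at [x = 0]; but a curve in the open chart stays away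
    from the faces, so [Xi_x] is Lipschitz along it with a constant depending on the curve, which
    suffices for absolute continuity, and the uniform constant appears only on comparison with the
    length. The speed of a curve and the bounds on [u] are controlled only almost everywhere;
    exceptional null sets are therefore removed from the integral of a measurable minorant, after
    which the comparison is pointwise. Finally, a real-valued integral takes the value 0 when the
    extended one is infinite, so positivity of [F] is what certifies that its defining integral is
    finite. *)

Section AbsoluteContinuity.
Context {R : realType}.
Notation TV := total_variation.
Notation leb := (@lebesgue_measure R).

(** The predicate [P] selects a subfamily without reindexing; it is used for the cells of a grid
    that lie in a given open set. *)
Definition nonoverlapping (T : finType) (P : pred T) (a b : R) (s t : T -> R) :=
  (forall i, P i -> [/\ a <= s i, s i <= t i & t i <= b]) /\
  (forall i j, P i -> P j -> i != j -> t i <= s j \/ t j <= s i).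

(* Unlike in [abs_continuous], the families are indexed by arbitrary finite
   types, so that refining each interval of a family stays within the definition. *)
Definition abs_cont (a b : R) (h : R -> R) : Prop :=
  forall e, 0 < e -> exists2 d, 0 < d &
    forall (T : finType) (P : pred T) (s t : T -> R),
      nonoverlapping P a b s t -> \sum_(i | P i) (t i - s i) < d ->
      \sum_(i | P i) `|h (t i) - h (s i)| < e.

Lemma abs_contP a b h :
  (forall e, 0 < e -> exists2 d, 0 < d &
    forall m (s t : 'I_m -> R),
      (forall i, a <= s i /\ s i <= t i /\ t i <= b) ->
      (forall i j, i != j -> t i <= s j \/ t j <= s i) ->
      \sum_(i < m) (t i - s i) < d ->
      \sum_(i < m) `|h (t i) - h (s i)| < e) ->
  abs_cont a b h.
Proof.
move=> ach e /ach[d d0 hd]; exists d => // T P s t [ab st].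
rewrite [X in X < d](big_enum_val (A := P) (fun i => t i - s i)).
rewrite [X in _ -> X < e](big_enum_val (A := P)
  (fun i => `|h (t i) - h (s i)|)).
apply: hd => [i|i j ij].
  by have [] := ab (enum_val i) (enum_valP i).
by apply: st; rewrite -?topredE ?(inj_eq enum_val_inj)//; exact: enum_valP.
Qed.

Lemma abs_contB a b f g :
  abs_cont a b f -> abs_cont a b g -> abs_cont a b (f \- g).
Proof.
move=> acf acg e e0.
have e20 : 0 < e / 2 by rewrite divr_gt0.
have [d d0 hd] := acf _ e20; have [d' d'0 hd'] := acg _ e20.
exists (Num.min d d'); first by rewrite lt_min d0.
move=> T P s t st; rewrite lt_min => /andP[/hd sd /hd' sd'].
rewrite (splitr e); apply: le_lt_trans (ltrD (sd st) (sd' st)).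
rewrite -big_split/=; apply: ler_sum => i _.
rewrite [X in `|X|](_ : _ = f (t i) - f (s i) - (g (t i) - g (s i))) ?ler_normB//.
by rewrite /=; ring.
Qed.

Lemma abs_cont_dist a b h : abs_cont a b h -> forall e, 0 < e ->
  exists2 d, 0 < d & forall x y, a <= x <= b -> a <= y <= b ->
    `|x - y| < d -> `|h x - h y| < e.
Proof.
move=> ach e /ach[d d0 hd]; exists d => // x y.
wlog xy : x y / x <= y => [H xab yab xyd|/andP[ax xb] /andP[ay yb] xyd].
  have [xy|/ltW yx] := leP x y; first exact: H.
  by rewrite distrC; apply: H => //; rewrite distrC.
have := hd unit predT (fun=> x) (fun=> y); rewrite !big_const.
rewrite card_unit/= !addr0 distrC; apply.
  by split=> // -[] [].
by move: xyd; rewrite distrC ger0_norm ?subr_ge0.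
Qed.

Lemma variation_sum (s t : R) h l : itv_partition s t l ->
  variation s t h l = \sum_(n < size l)
    `|h (nth t (s :: l) n.+1) - h (nth t (s :: l) n)|.
Proof. by rewrite /variation/= big_mkord. Qed.

Lemma itv_partition_mono (s t : R) l m n : itv_partition s t l ->
  (m <= n <= size l)%N -> nth t (s :: l) m <= nth t (s :: l) n.
Proof.
move=> [sl _] /andP[]; rewrite leq_eqVlt => /predU1P[->//|mn nl].
apply/ltW/sorted_ltn_nth => //=; first exact: lt_trans.
by rewrite inE/= ltnS (leq_trans (ltnW mn)).
Qed.

(* Choosing near-optimal partitions of all the intervals at once yields a single
   nonoverlapping family with the same total length. *)
Lemma abs_cont_total_variation a b h : abs_cont a b h -> forall e, 0 < e ->
  exists2 d, 0 < d & forall (T : finType) (P : pred T) (s t : T -> R),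
    nonoverlapping P a b s t -> \sum_(i | P i) (t i - s i) < d ->
    (\sum_(i | P i) TV (s i) (t i) h <= e%:E)%E.
Proof.
move=> ach e /ach[d d0 hd]; exists d => // T P s t [ab st] sd.
(* The cells of all partitions form one family indexed by a sigma type. Telescoping inside each
   interval gives its total length back, so the smallness of the original family carries over. *)
have refine (l : T -> seq R) : (forall i, P i -> itv_partition (s i) (t i) (l i)) ->
    \sum_(i | P i) variation (s i) (t i) h (l i) < e.
  move=> lP.
  pose J i : finType := 'I_(size (l i)).
  pose u (p : {i : T & J i}) := nth (t (tag p)) (s (tag p) :: l (tag p)) (tagged p).
  pose v (p : {i : T & J i}) := nth (t (tag p)) (s (tag p) :: l (tag p)) (tagged p).+1.
  under eq_bigr => i Pi do rewrite (variation_sum _ (lP i Pi)).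
  rewrite (sig_big_dep (J := J) P (fun _ _ => true) (fun i n =>
    `|h (nth (t i) (s i :: l i) n.+1) - h (nth (t i) (s i :: l i) n)|)).
  apply: (hd _ (fun p : {i : T & J i} => P (tag p) && true) u v); last first.
    rewrite -(sig_big_dep (J := J) P (fun _ _ => true) (fun i n =>
      nth (t i) (s i :: l i) n.+1 - nth (t i) (s i :: l i) n)).
    apply: le_lt_trans sd; apply: ler_sum => i Pi.
    rewrite -(big_mkord predT (fun n =>
      nth (t i) (s i :: l i) n.+1 - nth (t i) (s i :: l i) n)).
    by rewrite telescope_sumr// (itv_partition_nth_size _ (lP i Pi)).
  have bnd (i : T) (n : nat) : P i -> (n <= size (l i))%N ->
      s i <= nth (t i) (s i :: l i) n <= t i.
    move=> Pi ni; rewrite itv_partition_nth_ge ?ltnS ?itv_partition_nth_le//;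
    exact: lP.
  split.
    move=> [i n]/=; rewrite andbT => Pi; have [asi _ tib] := ab _ Pi.
    have /andP[su _] := bnd i n Pi (ltnW (ltn_ord n)).
    have /andP[_ vt] := bnd i n.+1 Pi (ltn_ord n).
    split; [exact: le_trans su| |exact: le_trans tib].
    by apply: (itv_partition_mono (lP i Pi)); rewrite leqnSn /= (ltn_ord n).
  move=> [i n] [j m]; rewrite /u /v /= !andbT => Pi Pj ij.
  have [eij|nij] := eqVneq i j; last first.
    have [tisj|tjsi] := st _ _ Pi Pj nij; [left|right].
      have /andP[_ vt] := bnd i n.+1 Pi (ltn_ord n).
      have /andP[su _] := bnd j m Pj (ltnW (ltn_ord m)).
      exact: le_trans (le_trans vt tisj) su.
    have /andP[_ vt] := bnd j m.+1 Pj (ltn_ord m).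
    have /andP[su _] := bnd i n Pi (ltnW (ltn_ord n)).
    exact: le_trans (le_trans vt tjsi) su.
  case: _ / eij in m ij Pj *.
  have [nm|mn|nm] := ltngtP n m.
  - by left; apply: (@itv_partition_mono _ _ _ n.+1 m (lP i Pi)); rewrite nm ltnW.
  - by right; apply: (@itv_partition_mono _ _ _ m.+1 n (lP i Pi)); rewrite mn ltnW.
  - by move: ij; rewrite (ord_inj nm) eqxx.
have single i : P i -> (TV (s i) (t i) h <= e%:E)%E.
  move=> Pi; apply: ge_ereal_sup => _ [_ [l lp <-] <-]; rewrite lee_fin.
  (* Finiteness of each variation has to precede the near-optimal choice. An arbitrary partition of
     the interval [i] is completed by the coarsest one elsewhere, which is empty on a degenerate
     interval since partitions are strictly increasing. *)
  pose L j := if j == i then l else if s j < t j then [:: t j] else [::].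
  have LP j : P j -> itv_partition (s j) (t j) (L j).
    rewrite /L; case: eqVneq => [->//|_] Pj.
    case: ifPn => [/itv_partition1//|]; rewrite -leNgt => ts.
    split=> //=; rewrite eq_le ts andbT.
    by have [] := ab _ Pj.
  apply/ltW/(le_lt_trans _ (refine L LP)).
  rewrite (bigD1 i)//= {1}/L eqxx lerDl; apply: sumr_ge0 => j _.
  by rewrite /variation; apply: sumr_ge0.
apply/lee_addgt0Pr => _/posnumP[x].
(* The slack is shared among at most [#|T|] intervals; the successor keeps the denominator positive
   when [T] is empty. *)
pose y := x%:num / #|T|.+1%:R.
have y0 : 0 < y by rewrite divr_gt0.
have /choice[l lP] i : exists l : seq R, P i -> itv_partition (s i) (t i) l /\
    (TV (s i) (t i) h <= (variation (s i) (t i) h l)%:E + y%:E)%E.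
  have [Pi|//] := boolP (P i); last by exists [::].
  have fin : TV (s i) (t i) h \is a fin_num.
    rewrite ge0_fin_numE ?(le_lt_trans (single i Pi)) ?ltry//.
    by apply: total_variation_ge0; have [] := ab _ Pi.
  have [_ [_ [l lp <-] <-] lty] := ub_ereal_sup_adherent y0 fin.
  by exists l => _; split=> //; rewrite -leeBlDr// ltW.
apply: (@le_trans _ _ (\sum_(i | P i)
  ((variation (s i) (t i) h (l i))%:E + y%:E))%E).
  by apply: lee_sum => i /lP[].
under eq_bigr do rewrite -EFinD.
rewrite sumEFin -EFinD lee_fin big_split/= lerD//.
  by apply/ltW/refine => i /lP[].
rewrite sumr_const -mulr_natr -mulrA ger_pMr//.
by rewrite mulrC ler_pdivrMr// mul1r ler_nat (leq_trans (max_card _)).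
Qed.

(** With [d] the modulus for the tolerance 1, cutting the interval into [N] cells of width [w < d]
    leaves variation at most 1 on each, and the total variation is additive over consecutive
    cells. *)
Lemma abs_cont_bounded_variation (a b : R) h : a <= b -> abs_cont a b h ->
  bounded_variation a b h.
Proof.
move=> ab ach; apply/bounded_variationP => //.
have [d d0 hd] := abs_cont_total_variation ach ltr01.
have short s t : a <= s -> s <= t -> t <= b -> t - s < d ->
    (TV s t h <= 1)%E.
  move=> as_ st tb tsd.
  have := hd unit predT (fun=> s) (fun=> t); rewrite !big_const card_unit/=.
  by rewrite addr0 adde0; apply.
pose N := (Num.truncn ((b - a) / d)).+1.
pose w := (b - a) / N%:R.
have w0 : 0 <= w by rewrite divr_ge0// subr_ge0.
have wd : w < d.
  by rewrite /w ltr_pdivrMr// mulrC -ltr_pdivrMr// truncnS_gt.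
have Nw : N%:R * w = b - a by rewrite /w mulrC divfK ?pnatr_eq0.
have fin k : (k <= N)%N -> TV a (a + k%:R * w) h \is a fin_num.
  elim: k => [_|k IH kN]; first by rewrite mul0r addr0 total_variationxx.
  have kw : a <= a + k%:R * w by rewrite lerDl mulr_ge0.
  have skw : a + k.+1%:R * w = a + k%:R * w + w.
    by rewrite -addn1 natrD mulrDl mul1r addrA.
  rewrite (total_variationD h kw) ?skw ?lerDl// fin_numD IH ?(ltnW kN)//=.
  rewrite ge0_fin_numE ?total_variation_ge0 ?lerDl//.
  apply: le_lt_trans (ltry 1); apply: short => //; first by rewrite lerDl.
    by rewrite -skw -lerBrDl -Nw ler_wpM2r// ler_nat.
  by rewrite addrC addKr.
by have := fin N (leqnn _); rewrite Nw subrKC; apply.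
Qed.

Lemma grid_cell (a w x : R) N : a < x -> x <= a + N%:R * w ->
  exists2 k, (k < N)%N & a + k%:R * w < x <= a + k.+1%:R * w.
Proof.
move=> ax; elim: N => [|N IH] xN.
  by move: xN; rewrite mul0r addr0 leNgt ax.
have [xN'|Nx] := leP x (a + N%:R * w); last by exists N; rewrite // Nx.
by have [k kN kx] := IH xN'; exists k => //; exact: leqW.
Qed.

(* Points of the open set U at distance at least w from its complement are
   covered by the grid cells of width w contained in U. *)
Lemma abs_cont_null_dominates (a b : R) (F : cumulative R R) :
  a < b -> abs_cont a b F -> forall A : set R, measurable A -> leb A = 0%E ->
  lebesgue_stieltjes_measure F (A `&` `]a, b]%classic) = 0%E.
Proof.
move=> ab acF A mA A0; set LS := lebesgue_stieltjes_measure F.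
have LSitv x y : x <= y -> LS `]x, y]%classic = (F y - F x)%:E.
  move=> xy; rewrite /LS /lebesgue_stieltjes_measure /measure_extension.
  by rewrite measurable_mu_extE/= ?wlength_itv_bnd//; exact: is_ocitv.
have mD : measurable (`]a, b]%classic : set R) by [].
apply/eqP; rewrite -measure_le0; apply/lee_addgt0Pr => e e0; rewrite add0e.
have [d d0 hd] := acF _ e0.
(* As [A] is null, an open superset exceeding it by less than [d] itself has measure less than [d],
   the modulus of [F] for the tolerance [e]. *)
have [|U [oU AU UAd]] := lebesgue_regularity_outer mA _ d0; first by rewrite [X in (X < _)%E]A0.
have mU : measurable U by exact: open_measurable.
have {UAd}Ud : (leb U < d%:E)%E.
  rewrite -(setDUK AU); apply: le_lt_trans UAd.
  by rewrite (le_trans (measureU2 _ _ _))//= ?A0 ?add0e//; exact: measurableD.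
pose w n : R := (b - a) / n.+1%:R.
have w0 n : 0 < w n by rewrite divr_gt0// subr_gt0.
pose C n := `]a, b]%classic `\` \bigcup_(y in ~` U) ball y (w n).
have mC n : measurable (C n).
  apply: measurableD => //; apply: open_measurable.
  by apply: bigcup_open => y _; exact: ball_open.
have ndC : {homo C : n m / (n <= m)%N >-> (n <= m)%O}.
  move=> n m nm; rewrite subsetEset; apply: setDS => x [y Uy yx].
  exists y => //; apply: le_ball yx.
  by rewrite /w ler_pM2l ?subr_gt0// lef_pV2 ?posrE// ler_nat ltnS.
have UC : \bigcup_n C n = U `&` `]a, b]%classic.
  apply/seteqP; split=> [x [n _ [Dx Ux]]|x [Ux Dx]].
    split=> //; apply: contrapT => nUx; apply: Ux.
    by exists x => //; exact: ballxx.
  have /(@nbhs_ballP R R)[r /= r0 rU] : nbhs x U by exact: open_nbhs_nbhs.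
  have [n nr] : exists n, w n < r.
    exists (Num.truncn ((b - a) / r)).
    by rewrite /w ltr_pdivrMr// mulrC -ltr_pdivrMr// truncnS_gt.
  exists n => //; split=> // -[y Uy yx]; apply: Uy; apply: rU.
  by apply: ball_sym; apply: le_ball yx; exact: ltW.
(* Two points of one half-open cell are less than [w n] apart, so a cell meeting [C n] lies in [U].
   The cells inside [U] have total length below [d], hence the increments of [F] over them sum to at
   most [e]. *)
have LSC n : (LS (C n) <= e%:E)%E.
  pose N := n.+1; pose x k : R := a + k%:R * w n.
  have xS k : x k.+1 = x k + w n by rewrite /x -addn1 natrD mulrDl mul1r addrA.
  have xN : x N = b by rewrite /x /w mulrC divfK// subrKC.
  have xle j k : (j <= k)%N -> x j <= x k.
    by move=> jk; rewrite /x lerD2l; apply: ler_wpM2r; rewrite ?ler_nat// ltW.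
  pose I (k : 'I_N) : set (measurableTypeR R) := `]x k, x k.+1]%classic.
  pose Q (k : 'I_N) := `[< I k `<=` U >].
  have mI (k : 'I_N) : Q k -> measurable (I k) by move=> _; exact: measurable_itv.
  have tI : trivIset (fun k => Q k) I.
    move=> j k _ _ [y []]; rewrite /I /= !in_itv/= => /andP[jy yj] /andP[ky yk].
    apply: ord_inj; apply/eqP; rewrite eqn_leq.
    apply/andP; split; rewrite leqNgt; apply/negP => lt.
      by have := lt_le_trans jy (le_trans yk (xle _ _ lt)); rewrite ltxx.
    by have := lt_le_trans ky (le_trans yj (xle _ _ lt)); rewrite ltxx.
  have CI : C n `<=` \big[setU/set0]_(k < N | Q k) I k.
    move=> y [/=]; rewrite in_itv/= -xN => /andP[ay yN] nU.
    have [k kN kyk] := grid_cell ay yN.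
    rewrite -bigcup_pred; exists (Ordinal kN) => //=.
    apply: asboolT => z; rewrite /I /= in_itv/= => kzk.
    apply: contrapT => Uz; apply: nU; exists z => //.
    move: kyk kzk; rewrite -!/(x _) xS => /andP[ky yk] /andP[kz zk].
    by rewrite /ball/= ltr_norml; apply/andP; split; lra.
  have mUI : measurable (\big[setU/set0]_(k < N | Q k) I k).
    exact: bigsetU_measurable.
  apply: (@le_trans _ _ (LS (\big[setU/set0]_(k < N | Q k) I k))).
    by apply: (@le_measure _ _ _ LS); rewrite ?inE; [exact: mC|exact: mUI|exact: CI].
  rewrite [leLHS](measure_bigsetU_ord_cond LS mI tI).
  rewrite (eq_bigr (fun k : 'I_N => (F (x k.+1) - F (x k))%:E)); last first.
    by move=> k _; apply: LSitv; exact: xle.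
  rewrite sumEFin lee_fin.
  apply: le_trans (ltW (hd _ Q (fun k => x k) (fun k => x k.+1) _ _)).
  - by apply: ler_sum => k _; exact: ler_norm.
  - split=> [k _|j k _ _ jk].
      split; [|exact: xle|by rewrite -xN; exact: xle].
      by rewrite /x lerDl mulr_ge0// ltW.
    case: (ltngtP j k) jk => [jk _|kj _|/ord_inj->]; last by rewrite eqxx.
    - by left; exact: xle.
    - by right; exact: xle.
  - rewrite -lte_fin -sumEFin; apply: le_lt_trans Ud.
    apply: (@le_trans _ _ (leb (\big[setU/set0]_(k < N | Q k) I k))); last first.
      apply: (@le_measure _ _ _ leb); rewrite ?inE; [exact: mUI|exact: mU|].
      by rewrite -bigcup_pred => y [k /= /asboolP]; exact.
    rewrite [leRHS](measure_bigsetU_ord_cond leb mI tI); apply: lee_sum => k _.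
    rewrite [leRHS](lebesgue_measure_itv `]x k, x k.+1]%O)/=.
    by rewrite lte_fin xS ltrDl w0.
apply: (@le_trans _ _ (LS (U `&` `]a, b]%classic))).
  apply: (@le_measure _ _ _ LS); rewrite ?inE.
  - exact: measurableI _ _ mA mD.
  - exact: measurableI _ _ mU mD.
  - exact: setSI.
(* The bound is uniform in [n] and passes to the increasing union by continuity from below. *)
have := nondecreasing_cvg_mu (mu := LS) mC _ ndC.
rewrite UC => /(_ (measurableI _ _ mU mD)) LSU.
rewrite -[leLHS](cvg_lim (@ereal_hausdorff R) LSU); apply: lime_le; last exact: nearW.
by apply/cvg_ex; eexists; exact: LSU.
Qed.

(** The density is the Radon-Nikodym derivative of the Lebesgue-Stieltjes measure of [G] restricted
    to the half-open interval; domination is the preceding lemma. *)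
Lemma nondecreasing_abs_cont_density (a b : R) G : a < b ->
  {in `[a, b] &, nondecreasing_fun G} -> abs_cont a b G ->
  exists2 phi : R -> R, leb.-integrable setT (EFin \o phi) &
    forall x, a <= x <= b -> G x - G a = \int[leb]_(t in `]a, x]) phi t.
Proof.
move=> ab ndG acG.
(* A Stieltjes function must be monotone and right continuous on the whole line; clamping the
   argument extends [G] by constants. As [clamp] is monotone and 1-Lipschitz, both properties
   survive. *)
pose clamp (x : R) := Num.max a (Num.min b x).
have clampE x : a <= x <= b -> clamp x = x.
  by move=> /andP[ax xb]; rewrite /clamp (min_idPr xb) (max_idPr ax).
have clamp_itv x : a <= clamp x <= b.
  by rewrite /clamp le_max lexx/= ge_max (ltW ab) ge_min lexx.
have clamp_nd x y : x <= y -> clamp x <= clamp y <= clamp x + (y - x).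
  rewrite /clamp => xy.
  by have [?|?] := leP b x; have [?|?] := leP b y; have [?|?] := leP a x;
    have [?|?] := leP a y; have [?|?] := leP a b; apply/andP; split; lra.
pose F0 := G \o clamp.
have F0nd : nondecreasing F0.
  move=> x y /clamp_nd/andP[xy _].
  by apply: ndG => //; rewrite in_itv/= clamp_itv.
have F0rc : right_continuous F0.
  move=> x; apply: cvg_within_filter; apply/cvgrPdist_lt => e e0.
  have [d d0 hd] := abs_cont_dist acG e0.
  near=> y; apply: hd => //.
  have : `|x - y| < d by near: y; exact: (@cvgr_dist_lt _ R).
  apply: le_lt_trans; have [xy|/ltW yx] := leP x y.
    have /andP[h1 h2] := clamp_nd _ _ xy.
    by rewrite ler0_norm ?ler0_norm ?subr_le0//; lra.
  have /andP[h1 h2] := clamp_nd _ _ yx.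
  by rewrite ger0_norm ?ger0_norm ?subr_ge0//; lra.
pose F : cumulative R R := HB.pack F0 (isCumulative.Build R _ R F0 F0nd F0rc).
pose LS := lebesgue_stieltjes_measure F.
have LSitv x y : x <= y -> LS `]x, y]%classic = (F y - F x)%:E.
  move=> xy; rewrite /LS /lebesgue_stieltjes_measure /measure_extension.
  by rewrite measurable_mu_extE/= ?wlength_itv_bnd//; exact: is_ocitv.
pose D : set (measurableTypeR R) := `]a, b]%classic.
have mD : measurable D by exact: measurable_itv.
have Doo : (LS D < +oo)%E by rewrite LSitv ?ltW// ltry.
have FG x : a <= x <= b -> F x = G x by move=> xab; rewrite /F/= /F0/= clampE.
have acF : abs_cont a b F.
  move=> e /acG[d d0 hd]; exists d => // T P s t st sd.
  have := hd _ _ _ _ st sd; apply: le_lt_trans; apply: ler_sum => i Pi.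
  by have [as_ sti tb] := st.1 i Pi; rewrite !FG ?as_ ?(le_trans as_)// (le_trans sti).
have [|f [f0 ffin intf fE]] :=
    @radon_nikodym_sigma_finite _ _ _ leb (mfrestr mD Doo).
  apply/null_content_dominatesP => A mA A0.
  exact: (abs_cont_null_dominates ab acF mA A0).
exists (fine \o f).
  apply: eq_integrable intf => // x _ /=.
  by rewrite fineK.
move=> x /andP[ax xb].
rewrite /Rintegral; under eq_integral do rewrite /= fineK//.
have mx : measurable (`]a, x]%classic : set (measurableTypeR R)).
  exact: measurable_itv.
rewrite -fE//= /mfrestr /mrestr.
have -> : `]a, x]%classic `&` D = `]a, x]%classic.
  by apply/setIidl; apply: subset_itvl; rewrite bnd_simp.
rewrite -(FG x) ?ax// -(FG a) ?lexx ?(ltW ab)//.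
by rewrite [X in fine X](LSitv _ _ ax).
Unshelve. all: by end_near. Qed.

(** Jordan decomposition: [h = V - (V - h)] with [V] the variation from [a]. Both terms are
    nondecreasing and absolutely continuous, so the density is the difference of theirs. *)
Lemma abs_cont_density (a b : R) h : a < b -> abs_cont a b h ->
  exists2 phi : R -> R, leb.-integrable setT (EFin \o phi) &
    forall x, a <= x <= b -> h x - h a = \int[leb]_(t in `]a, x]) phi t.
Proof.
move=> ab ach.
have bv := abs_cont_bounded_variation (ltW ab) ach.
have TVfin x y : a <= x -> x <= y -> y <= b -> TV x y h \is a fin_num.
  move=> ax xy yb; apply/bounded_variationP => //.
  apply: (bounded_variationl xy yb); apply: bounded_variationr bv => //.
  exact: le_trans yb.
pose V x := fine (TV a x h).
have VB x y : a <= x -> x <= y -> y <= b -> V y - V x = fine (TV x y h).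
  move=> ax xy yb; rewrite /V (total_variationD h ax xy).
  rewrite fineD ?TVfin ?(le_trans xy yb)//.
  by rewrite addrAC subrr add0r.
have VBge x y : a <= x -> x <= y -> y <= b -> `|h y - h x| <= V y - V x.
  move=> ax xy yb; rewrite VB// -lee_fin fineK ?TVfin//.
  exact: total_variation_ge.
have ndV : {in `[a, b] &, nondecreasing_fun V}.
  move=> x y; rewrite !in_itv/= => /andP[ax _] /andP[_ yb] xy.
  by rewrite -subr_ge0 (le_trans _ (VBge _ _ ax xy yb)).
have acV : abs_cont a b V.
  (* The variation estimate is only a weak inequality; halving the tolerance recovers the strict
     one. *)
  move=> e e0; have e20 : 0 < e / 2 by rewrite divr_gt0.
  have [d d0 hd] := abs_cont_total_variation ach e20.
  exists d => // T P s t st sd.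
  apply: (@le_lt_trans _ _ (e / 2)); last by rewrite gtr_pMr// invf_lt1 ?ltr1n.
  rewrite -lee_fin -sumEFin; apply: le_trans (hd _ _ _ _ st sd).
  apply: lee_sum => i Pi; have [as_ sti tb] := st.1 i Pi.
  rewrite VB// ger0_norm ?fineK ?TVfin//.
  by rewrite fine_ge0// total_variation_ge0.
have ndW : {in `[a, b] &, nondecreasing_fun (V \- h)}.
  move=> x y; rewrite !in_itv/= => /andP[ax _] /andP[_ yb] xy.
  by have := le_trans (ler_norm _) (VBge _ _ ax xy yb); lra.
have [p intp pE] := nondecreasing_abs_cont_density ab ndV acV.
have [q intq qE] := nondecreasing_abs_cont_density ab ndW (abs_contB acV ach).
exists (p \- q); first exact: (integrableB _ intp intq).
move=> x xab; rewrite RintegralB//.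
- by rewrite -pE// -qE//=; ring.
- exact: integrableS intp.
- exact: integrableS intq.
Qed.

(** Lebesgue differentiation applied to the primitive of the density. The density is kept in the
    statement alongside the derivative because it is measurable and defined everywhere, while the
    derivative is identified only almost everywhere. *)
Lemma abs_cont_FTC (a b : R) h : a < b -> abs_cont a b h ->
  exists phi : R -> R, [/\ leb.-integrable setT (EFin \o phi),
    h b - h a = \int[leb]_(t in `]a, b]) phi t &
    {ae leb, forall t, a < t < b -> derivable h t 1 /\ h^`()%classic t = phi t}].
Proof.
move=> ab ach; have [phi intphi hE] := abs_cont_density ab ach.
exists phi; split=> //; first by apply: hE; rewrite lexx (ltW ab).
have intphiS y : leb.-integrable [set` Interval (BRight a) (BRight y)] (EFin \o phi).
  exact: integrableS intphi.
have locphi : locally_integrable setT phi.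
  exact: open_integrable_locally openT intphi.
have := FTC1 intphiS locphi.
apply: filterS; first exact: (ae_filter_ringOfSetsType leb).
move=> t; rewrite lte_fin => + /andP[at_ tb] => /(_ at_).
set F := fun x => _; move=> [dF F't].
pose H := F \+ cst (h a).
have hH : {near t, H =1 h}.
  near=> x; rewrite /H/= /F -hE ?subrK//.
  apply/andP; split; near: x; [exact: lt_le_nbhsr|exact: lt_le_nbhsl].
have dH : derivable H t 1.
  by apply: derivableD => //; exact: derivable_cst.
split; first exact: near_eq_derivable hH dH.
have htH : \forall x \near t, h x = H x by near=> x; apply/esym; near: x.
rewrite derive1E (near_eq_derive _ htH).
rewrite (deriveD dF (derivable_cst _ _ _)).
by rewrite derive_cst addr0 -derive1E.
Unshelve. all: by end_near. Qed.

End AbsoluteContinuity.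

(** * Lengths of curves *)

Section LowerIntegral.
Local Open Scope ereal_scope.
Context d (T : measurableType d) (R : realType).
Variable mu : {measure set T -> \bar R}.

(* For a nonnegative integrand the library's integral is a supremum over simple
   functions, so that monotonicity requires no measurability. *)
Lemma ge0_subset_le_integral (D1 D2 : set T) (f1 f2 : T -> \bar R) :
  D1 `<=` D2 -> (forall x, D1 x -> 0 <= f1 x) -> (forall x, D2 x -> 0 <= f2 x) ->
  (forall x, D1 x -> f1 x <= f2 x) ->
  \int[mu]_(x in D1) f1 x <= \int[mu]_(x in D2) f2 x.
Proof.
move=> D12 f10 f20 f12; rewrite !ge0_integralE//.
apply: ereal_sup_le => _ [h /= hf <-]; exists h => // x.
apply: le_trans (hf x) _; rewrite /patch.
case: ifPn => [/set_mem D1x|D1x].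
  by rewrite mem_set; [exact: f12|exact: D12].
by case: ifPn => // /set_mem /f20.
Qed.

End LowerIntegral.

Section Curves.
Context {R : realType}.
Notation leb := (@lebesgue_measure R).

Lemma qform1E n (v : 'rV[R]_n) : qform 1%:M v = \sum_j v 0 j ^+ 2.
Proof.
by rewrite /qform mulmx1 mxE; apply: eq_bigr => j _; rewrite mxE expr2.
Qed.

Lemma sqr_coord_le n (v : 'rV[R]_n) j : v 0 j ^+ 2 <= qform 1%:M v.
Proof.
rewrite qform1E (bigD1 j)//= lerDl; apply: sumr_ge0 => i _; exact: sqr_ge0.
Qed.

Lemma coord_le_enorm n (v : 'rV[R]_n) j : `|v 0 j| <= enorm v.
Proof. by rewrite -sqrtr_sqr ler_wsqrtr// sqr_coord_le. Qed.

Lemma abs_continuous_coord n (a b : R) (c : R -> 'rV[R]_n) j :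
  abs_continuous a b c -> abs_cont a b (fun t => c t 0 j).
Proof.
move=> acc; apply: abs_contP => e /acc[d d0 hd]; exists d => // m s t ab st sd.
apply: le_lt_trans (hd m s t ab st sd); apply: ler_sum => i _.
by apply: le_trans (coord_le_enorm _ j); rewrite !mxE.
Qed.

(** At almost every time the chain rule gives [(f \o c)' = 'd f (c')], bounded by [L] times the
    speed; the increment of [f \o c] is the integral of its density, which equals that derivative
    almost everywhere. *)
Lemma le_curve_length n (A : set 'rV[R]_n) (g : 'rV[R]_n -> 'M[R]_n)
    (f : 'rV[R]_n -> R) (L : R) p q c :
  0 < L -> curve_between A p q c -> abs_cont 0 1 (f \o c) ->
  (forall x, A x -> differentiable f x /\
     forall v, `|'d f x v| <= L * metric_norm g x v) ->
  (`|f p - f q|%:E <= L%:E * curve_length g c)%E.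
Proof.
move=> L0 [acc cA <- <-] acfc fA.
have [phi [intphi fcE phiE]] := abs_cont_FTC ltr01 acfc.
have cE : {ae leb, forall t, forall j : 'I_n, 0 < t < 1 ->
    derivable (fun t => c t 0 j) t 1}.
  have FF := ae_filter_ringOfSetsType leb.
  apply: (@filter_forall _ _ _ _ FF) => j.
  have [psi [_ _]] := abs_cont_FTC ltr01 (abs_continuous_coord j acc).
  by apply: filterS => t H /H[].
have [N [mN N0 PN]] : {ae leb, forall t, 0 < t < 1 ->
    `|phi t| <= L * metric_norm g (c t) (derive1 c t)}.
  have FF := ae_filter_ringOfSetsType leb.
  have := @filterI _ _ FF _ _ phiE cE; apply: filterS => t [+ +] t01.
  move=> /(_ t01)[_ <-] /(_ _ t01) dct.
  have /derivable1_diffP dc : derivable c t 1.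
    by apply/derivable_mxP => i j; rewrite ord1; exact: dct.
  have /andP[t0 t1] := t01.
  have [|dfc fb] := fA (c t); first by apply: cA; rewrite !ltW.
  rewrite derive1E' ; last exact: differentiable_comp.
  rewrite diff_comp//= derive1E'//; exact: fb.
pose I : set (measurableTypeR R) := `]0, 1[%classic.
have mI : measurable I by exact: measurable_itv.
have intI : leb.-integrable I (EFin \o phi) by exact: integrableS intphi.
rewrite distrC -/((f \o c) 1) -/((f \o c) 0) fcE.
(* The endpoint 1 is dropped: the derivative is controlled only at interior times. *)
rewrite -Rintegral_itv_bndo_bndc; last first.
  by have /integrableP[/measurable_EFinP] := intI.
apply: (@le_trans _ _ (\int[leb]_(t in I) `|phi t|%:E)%E).
  rewrite EFin_normr_Rintegral//.
  by apply: le_trans (le_abse_integral _ _ _) _ => //; have /integrableP[] := intI.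
rewrite -lee_pdivrMl//.
have mphi : measurable_fun I (fun t => `|phi t|%:E).
  apply/measurable_EFinP; apply: measurableT_comp => //.
  by have /integrableP[/measurable_EFinP] := intI.
rewrite -ge0_integralZl_EFin//; last by rewrite invr_ge0 ltW.
(* The null set is removed on the side of [phi], which is measurable; the comparison with the speed
   is then pointwise and only enlarges the domain. *)
rewrite (@ge0_negligible_integral _ _ _ leb _ N)//; last 2 first.
- exact: measurable_funeM.
- by move=> t _; rewrite mule_ge0// lee_fin// invr_ge0 ltW.
apply: ge0_subset_le_integral.
- by move=> t [+ _]; rewrite /I /= !in_itv/= => /andP[t0 t1]; rewrite !ltW.
- by move=> t _; rewrite mule_ge0// lee_fin// invr_ge0 ltW.
- by move=> t _; rewrite lee_fin sqrtr_ge0.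
- move=> t []; rewrite /I /= in_itv/= => t01 Nt.
  rewrite -EFinM lee_fin ler_pdivrMl//.
  by have := subsetCl PN Nt; apply.
Qed.

Lemma le_intrinsic_dist n (A : set 'rV[R]_n) (g : 'rV[R]_n -> 'M[R]_n)
    (f : 'rV[R]_n -> R) (L : R) p q :
  0 < L -> (forall c, curve_between A p q c -> abs_cont 0 1 (f \o c)) ->
  (forall x, A x -> differentiable f x /\
     forall v, `|'d f x v| <= L * metric_norm g x v) ->
  (`|f p - f q|%:E <= L%:E * intrinsic_dist A g p q)%E.
Proof.
move=> L0 acf fA; rewrite -lee_pdivrMl//.
apply: le_ereal_inf_tmp => _ [c cpq <-]; rewrite lee_pdivrMl//.
exact: le_curve_length (acf _ cpq) fA.
Qed.

End Curves.

(** * Exponent profiles *)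

Lemma powR_continuous_at (R : realType) (r x : R) : 0 < x ->
  {for x, continuous (fun t => t `^ r)}.
Proof.
move=> x0.
have E : {near x, (fun t => expR (r * ln t)) =1 (fun t => t `^ r)}.
  near=> t; rewrite /powR gt_eqF//; near: t; exact: lt_nbhsr.
have : expR (r * ln t) @[t --> x] --> x `^ r.
  rewrite /powR gt_eqF//.
  apply: (continuous_comp (f := fun t => r * ln t)); last exact: continuous_expR.
  by apply: cvgMr; exact: continuous_ln.
by apply: cvg_trans; apply: near_eq_cvg; near=> t; near: t; exact: E.
Unshelve. all: by end_near. Qed.

Lemma measurable_powRr (R : realType) d (T : measurableType d) (E : set T)
    (p : T -> R) (t : R) : 0 < t -> measurable_fun E p ->
  measurable_fun E (fun a => t `^ (- p a)).
Proof.
move=> t0 mp; rewrite (_ : (fun _ => _) = (fun a => expR (- p a * ln t))).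
  apply: measurableT_comp; first exact: measurable_expR.
  by apply: measurable_funM; [exact: measurableT_comp|exact: measurable_cst].
by apply/funext => a; rewrite /powR gt_eqF.
Qed.

Section ExponentProfile.
Context d (T : measurableType d) (R : realType).
Variables (mu : {finite_measure set T -> \bar R}) (E : set T) (p : T -> R) (K : R).
Hypothesis mE : measurable E.
Hypothesis mp : measurable_fun E p.
Hypothesis pK : forall a, E a -> 0 <= p a <= K.
Notation leb := (@lebesgue_measure R).

(** Both marginal profiles have this form, with [p] the first or the second component of the
    exponent. *)
Let M (t : R) := \int[mu]_(a in E) t `^ (- p a).

Let le_powR (a : T) (s t : R) : 0 < s -> s <= t -> E a ->
  t `^ (- p a) <= s `^ (- p a).
Proof.
move=> s0 st Ea; have t0 := lt_le_trans s0 st.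
rewrite !powRN lef_pV2 ?posrE ?powR_gt0//.
have /andP[p0 _] := pK Ea.
by apply: ge0_ler_powR => //; rewrite nnegrE ltW.
Qed.

(** The upper bound does not depend on [a], so it is an integrable dominating function for the
    finite measure; the lower bound yields [mu(E) <= M t]. *)
Let powR_itv (a : T) (u t : R) : 0 < u -> u <= t -> t <= 1 -> E a ->
  1 <= t `^ (- p a) <= u `^ (- K).
Proof.
move=> u0 ut t1 Ea; have t0 := lt_le_trans u0 ut.
have /andP[p0 pKa] := pK Ea.
apply/andP; split.
  by rewrite -[leLHS](powRr0 t); apply: ger_powR; rewrite ?t0// oppr_le0.
apply: le_trans (le_powR u0 ut Ea) _.
by apply: ger_powR; rewrite ?u0 ?(le_trans ut)// lerN2.
Qed.

Lemma finite_measure_lty : (mu E < +oo)%E.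
Proof. by rewrite ltey_eq fin_num_measure. Qed.

Lemma profile_integrable (t : R) : 0 < t -> t <= 1 ->
  mu.-integrable E (fun a => (t `^ (- p a))%:E).
Proof.
move=> t0 t1; apply: measurable_bounded_integrable => //.
- exact: finite_measure_lty.
- exact: measurable_powRr.
- exists (t `^ (- K)); split; first exact: num_real.
  move=> x tx a /= Ea; have /andP[h1 h2] := powR_itv t0 (lexx t) t1 Ea.
  by rewrite ger0_norm ?powR_ge0// (le_trans h2)// ltW.
Qed.

Lemma profile_ge (t : R) : 0 < t -> t <= 1 -> fine (mu E) <= M t.
Proof.
move=> t0 t1; rewrite -[leLHS]mul1r -(Rintegral_cst mu mE).
apply: le_Rintegral => //.
- exact: finite_measure_integrable_cst.
- exact: profile_integrable.
- by move=> a Ea; have /andP[] := powR_itv t0 (lexx t) t1 Ea.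
Qed.

Lemma profile_ge0 t : 0 <= M t.
Proof. by apply: Rintegral_ge0 => a _; exact: powR_ge0. Qed.

Lemma profile_nonincreasing (s t : R) : 0 < s -> s <= t -> t <= 1 -> M t <= M s.
Proof.
move=> s0 st t1; apply: le_Rintegral => //.
- by apply: profile_integrable => //; exact: lt_le_trans st.
- by apply: profile_integrable => //; exact: le_trans t1.
- by move=> a Ea; exact: le_powR.
Qed.

(** Dominated convergence on the neighbourhood from [t / 2] to 1, where every integrand is at most
    the constant at [t / 2]. *)
Lemma profile_continuous (t : R) : 0 < t < 1 -> {for t, continuous M}.
Proof.
move=> /andP[t0 t1]; pose u := t / 2.
have u0 : 0 < u by rewrite divr_gt0.
have ut : u < t by rewrite /u gtr_pMr// invf_lt1 ?ltr1n.
apply: (@continuity_under_integral R _ T mu (fun t a => t `^ (- p a)) E mE u 1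
  _ _ (cst (u `^ (- K)))).
- move=> x /=; rewrite in_itv/= => /andP[ux x1].
  by apply: profile_integrable; [exact: lt_trans ux|exact: ltW].
- apply: aeW => a Ea x; rewrite inE/= in_itv/= => /andP[ux x1].
  by apply: powR_continuous_at; exact: lt_trans ux.
- exact: finite_measure_integrable_cst.
- move=> x /=; rewrite in_itv/= => /andP[ux x1]; apply: aeW => a Ea.
  rewrite ger0_norm ?powR_ge0//.
  by have /andP[] := powR_itv u0 (ltW ux) (ltW x1) Ea.
- by rewrite inE/= in_itv/= ut.
Qed.

Lemma sqrt_profile_continuous (t : R) : 0 < t < 1 ->
  {for t, continuous (fun t => Num.sqrt (M t))}.
Proof.
move=> t01; apply: (continuous_comp (f := M)); first exact: profile_continuous.
exact: sqrt_continuous.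
Qed.

Variable eps : R.
Hypothesis eps_gt0 : 0 < eps.
Hypothesis eps_lt1 : eps < 1.
Hypothesis intM : sqrt_integrable `]0, eps[ M.

Let I : set (measurableTypeR R) := `]0, eps[%classic.

Let integrable_sqrt : leb.-integrable I (EFin \o (fun t => Num.sqrt (M t))).
Proof.
apply/integrableP; split.
  apply/measurable_EFinP; apply: open_continuous_measurable_fun.
    exact: interval_open.
  move=> t; rewrite inE /I /= in_itv/= => /andP[t0 te].
  by apply: sqrt_profile_continuous; rewrite t0 (lt_trans te).
apply: le_lt_trans intM; rewrite le_eqVlt; apply/orP; left; apply/eqP.
by apply: eq_integral => t _ /=; rewrite ger0_norm ?sqrtr_ge0.
Qed.

Let integrable_sqrt_oc (x : R) : x < eps ->
  leb.-integrable `]0, x] (EFin \o (fun t => Num.sqrt (M t))).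
Proof.
move=> xe; apply: integrableS integrable_sqrt.
- exact: measurable_itv.
- exact: measurable_itv.
- by move=> t /=; rewrite /I/= !in_itv/= => /andP[-> tx]; exact: le_lt_trans xe.
Qed.

Lemma is_derive_sqrt_primitive (x : R) : 0 < x < eps ->
  is_derive x 1 (sqrt_primitive M) (Num.sqrt (M x)).
Proof.
move=> /andP[x0 xe]; pose u := (x + eps) / 2.
have /andP[xu ue] : x < u < eps by rewrite /u; apply/andP; split; lra.
have [||dF F'] := continuous_FTC1 xu (integrable_sqrt_oc ue).
- by rewrite lte_fin.
- by apply: sqrt_profile_continuous; rewrite x0 (lt_trans xe).
by apply: DeriveDef; rewrite // -derive1E.
Qed.

(** By the mean value theorem the slope is [sqrt (M c)] at an intermediate [c], and
    [mu(E) <= M c <= M x] by monotonicity. The upper bound gives a Lipschitz constant away from 0,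
    the lower one linear growth. *)
Lemma sqrt_primitiveB (x y : R) : 0 < x -> x <= y -> y < eps ->
  Num.sqrt (fine (mu E)) * (y - x) <= sqrt_primitive M y - sqrt_primitive M x
    <= Num.sqrt (M x) * (y - x).
Proof.
move=> x0 xy ye.
have dF z : x <= z <= y -> is_derive z 1 (sqrt_primitive M) (Num.sqrt (M z)).
  move=> /andP[xz zy]; apply: is_derive_sqrt_primitive.
  by rewrite (lt_le_trans x0)// (le_lt_trans zy).
have [||c] := MVT_segment (f := sqrt_primitive M)
    (df := fun z => Num.sqrt (M z)) xy.
- move=> z; rewrite in_itv/= => /andP[xz zy].
  by apply: dF; rewrite !ltW.
- apply: derivable_within_continuous => z; rewrite in_itv/= => xzy.
  by have [] := dF z xzy.
rewrite in_itv/= => /andP[xc cy] ->.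
have c1 : c <= 1 by rewrite (le_trans cy)// ltW// (lt_trans ye).
rewrite !ler_wpM2r ?subr_ge0// ?ler_wsqrtr//.
  exact: profile_nonincreasing.
by apply: profile_ge => //; exact: lt_le_trans xc.
Qed.

Lemma sqrt_primitive_ge0 x : 0 <= sqrt_primitive M x.
Proof. by apply: Rintegral_ge0 => t _; exact: sqrtr_ge0. Qed.

Lemma sqrt_primitive_ge (x : R) : 0 < x -> x < eps ->
  Num.sqrt (fine (mu E)) * x <= sqrt_primitive M x.
Proof.
move=> x0 xe; apply/ler_addgt0Pl => e e0.
pose s := Num.sqrt (fine (mu E)).
have s0 : 0 <= s by exact: sqrtr_ge0.
(* The lower increment bound is used from [y] to [x]; the part below [y] costs at most [s * y <= e].
   The summand 1 covers the case [s = 0]. *)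
pose y := Num.min x (e / (s + 1)).
have y0 : 0 < y by rewrite lt_min x0 divr_gt0// ltr_wpDl.
have yx : y <= x by rewrite ge_min lexx.
have sy : s * y <= e.
  apply: (@le_trans _ _ ((s + 1) * y)).
    by rewrite ler_wpM2r ?lerDl// ltW.
  by rewrite mulrC -ler_pdivlMr ?ltr_wpDl// ge_min lexx orbT.
have /andP[+ _] := sqrt_primitiveB y0 yx xe.
have := sqrt_primitive_ge0 y; rewrite -/s; lra.
Qed.

Lemma sqrt_primitive_cvg0 : sqrt_primitive M x @[x --> 0^'+] --> (0 : R).
Proof.
pose f t := Num.sqrt (M t); pose u := eps / 2.
have u0 : 0 < u by rewrite divr_gt0.
have ue : u < eps by rewrite /u gtr_pMr// invf_lt1 ?ltr1n.
have intf : leb.-integrable `[0, u] (EFin \o f).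
  have /integrableP[mf fi] := integrable_sqrt_oc ue.
  apply/integrableP; split.
    by apply/measurable_EFinP/measurable_fun_itv_obnd_cbndP/measurable_EFinP.
  rewrite -integral_itv_obnd_cbnd//.
  exact: measurableT_comp mf.
have := parameterized_integral_cvg_left u0 intf.
move=> /cvg_at_right_filter; apply: cvg_trans; apply: near_eq_cvg.
near=> x; rewrite /parameterized_integral /sqrt_primitive.
by rewrite Rintegral_itv_obnd_cbnd//; apply: integrable_sqrt_oc; near: x; exact: nbhs_right_lt.
Unshelve. all: by end_near. Qed.

End ExponentProfile.

(** The support is defined by the topology of the plane, its measurability by the product of Borel
    sigma-algebras. The link is that an open set is the union of the countably many rational boxes
    it contains. *)
Lemma open_prod_measurable (R : realType) (O : set (R * R)) : open O ->
  measurable (O : set (exponents R)).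
Proof.
move=> oO.
pose box (q : (rat * rat) * (rat * rat)) : set (exponents R) :=
  `]ratr q.1.1, ratr q.1.2[%classic `*` `]ratr q.2.1, ratr q.2.2[%classic.
have -> : O = \bigcup_q (if `[< box q `<=` O >] then box q else set0).
  apply/seteqP; split=> [[x y] Oxy|x [q _]]; last first.
    by case: ifPn => // /asboolP; exact.
  have /(@nbhs_ballP R (R * R)%type)[e /= e0 eO] : nbhs (x, y) O.
    exact: open_nbhs_nbhs.
  have hull (z : R) : exists q : rat * rat, [/\ ratr q.1 < z, z < ratr q.2,
      z - e < ratr q.1 & ratr q.2 < z + e].
    have [q1] := @rat_in_itvoo R (z - e) z (ltac:(by rewrite ltrBlDr ltrDl)).
    rewrite in_itv/= => /andP[? ?].
    have [q2] := @rat_in_itvoo R z (z + e) (ltac:(by rewrite ltrDl)).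
    by rewrite in_itv/= => /andP[? ?]; exists (q1, q2).
  have [p [p1 p2 p3 p4]] := hull x; have [q [q1 q2 q3 q4]] := hull y.
  have bO : box (p, q) `<=` O.
    move=> [a b] [/=]; rewrite !in_itv/= => /andP[pa ap] /andP[qb bq].
    by apply: eO; split; rewrite /ball/= ltr_norml; apply/andP; split; lra.
  exists (p, q) => //; rewrite ifT; last exact/asboolP.
  by split; rewrite /= in_itv/=; apply/andP.
apply: countable_bigcupT_measurable => //.
move=> q; case: ifPn => // _.
by apply: measurableX; exact: measurable_itv.
Qed.

(** * Measurability and boundedness of the support *)

Section Support.
Context (R : realType).
Variable mu : {finite_measure set (exponents R) -> \bar R}.
Hypothesis supp_compact : compact (msupport mu).

Lemma msupport_measurable : measurable (msupport mu : set (exponents R)).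
Proof.
rewrite -[X in measurable X](setCK (msupport mu)); apply: measurableC.
apply: open_prod_measurable; apply: closed_openC.
exact: compact_closed (@norm_hausdorff R (R * R)%type) supp_compact.
Qed.

Lemma msupport_bounded : exists K : R, forall a, msupport mu a ->
  a.1 <= K /\ a.2 <= K.
Proof.
have [M [_ MP]] := compact_bounded (supp_compact : compact (msupport mu)).
(* Boundedness provides an estimate by every number strictly above [M]; the norm of a pair is the
   maximum of the two absolute values. *)
exists (M + 1) => a Ea.
have : Num.max `|a.1| `|a.2| <= M + 1.
  by apply: MP Ea; rewrite ltrDl.
rewrite ge_max => /andP[a1 a2].
by split; [exact: le_trans (ler_norm _) a1|exact: le_trans (ler_norm _) a2].
Qed.

Lemma le_max_weight a : msupport mu a -> a.1 + a.2 <= max_weight mu.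
Proof.
move=> Ea; apply: ub_le_sup; last by exists a.
have [K KP] := msupport_bounded.
by exists (K + K) => _ [b /KP[b1 b2] <-]; exact: lerD.
Qed.

End Support.

(** * From the Laplace profile to the marginal profiles *)

Section LaplaceComparison.
Context d (T : measurableType d) (R : realType).
Variables (mu : {finite_measure set T -> \bar R}) (E : set T).
Variables (p q : T -> R) (K : R).
Hypothesis mE : measurable E.
Hypothesis mp : measurable_fun E p.
Hypothesis mq : measurable_fun E q.
Hypothesis pK : forall a, E a -> 0 <= p a <= K.
Hypothesis q_ge0 : forall a, E a -> 0 <= q a.
Hypothesis qp : forall a, E a -> q a <= 2 - p a.
Notation leb := (@lebesgue_measure R).

Let M (t : R) := \int[mu]_(a in E) t `^ (- p a).
Let L (S : R) := \int[mu]_(a in E) expR (- (S * q a)).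

(** Moved under the root, the Jacobian becomes [expR (- S) ^+ 2], and the integrand turns into
    [expR (- (S * (2 - p a)))]; this is at most the Laplace integrand because [q <= 2 - p]. *)
Let sqrt_profile_exp (S : R) : 0 <= S ->
  Num.sqrt (M (expR (- S))) * expR (- S) <= Num.sqrt (L S).
Proof.
move=> S0; have e0 : 0 < expR (- S) by exact: expR_gt0.
have e1 : expR (- S) <= 1 by rewrite -expR0 ler_expR oppr_le0.
rewrite -[X in _ * X](ger0_norm (expR_ge0 _)) -sqrtr_sqr -sqrtrM.
  apply: ler_wsqrtr; rewrite mulrC.
  have intM := profile_integrable mu mE mp pK e0 e1.
  rewrite -(RintegralZl _ mE intM); apply: le_Rintegral => //.
  - exact: (integrableZl mE (expR (- S) ^+ 2) intM).
  (* The sign condition on [q], which expresses [A_mu <= 2], bounds the Laplace integrand by 1 and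
     so makes it integrable. *)
  - apply: measurable_bounded_integrable => //.
    + exact: finite_measure_lty.
    + apply: measurableT_comp => //; apply: measurableT_comp => //.
      by apply: measurable_funM => //; exact: measurable_cst.
    + exists 1; split; first exact: num_real.
      move=> x x1 a /= Ea; rewrite ger0_norm ?expR_ge0//.
      apply: le_trans (ltW x1); rewrite -expR0 ler_expR oppr_le0 mulr_ge0//.
      exact: q_ge0.
  - move=> a Ea; rewrite /powR gt_eqF// expRK -expRM_natl -expRD ler_expR.
    have := qp Ea; have := ler_wpM2l S0 (qp Ea).
    by lra.
by apply: Rintegral_ge0 => a _; exact: powR_ge0.
Qed.

Let expN_derive1 : (fun S : R => expR (- S))^`()%classic = fun S => - expR (- S).
Proof.
apply/funext => S; rewrite derive1E.
apply: derive_val.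
have := @is_derive1_comp R expR -%R S (expR (- S)) (-1) _ _.
by rewrite mulrN1; apply.
Qed.

(** The substitution is made on compact pieces, each bounded by the same Laplace integral, and
    monotone convergence exhausts the interval from 0 to [dl]. On the remaining interval up to [eps]
    the profile is at most its value at [dl]. *)
Lemma sqrt_integrable_of_laplace (eps S0 : R) : 0 < eps -> eps < 1 -> 0 <= S0 ->
  sqrt_integrable `[S0, +oo[ L -> sqrt_integrable `]0, eps[ M.
Proof.
move=> eps0 eps1 S00 intL.
pose F (S : R) := expR (- S); pose f t := Num.sqrt (M t).
(* Exceeding [S0] places all pieces in the range of the Laplace hypothesis; exceeding [- ln eps]
   makes [dl = expR (- s)] smaller than [eps]. *)
pose s := Num.max S0 (- ln eps) + 1.
have S0s : S0 < s by rewrite ltr_pwDr// le_max lexx.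
have s0 : 0 < s by exact: le_lt_trans S0s.
have lns : - ln eps < s by rewrite ltr_pwDr// le_max lexx orbT.
pose dl := F s.
have dl0 : 0 < dl by exact: expR_gt0.
have dle : dl < eps by rewrite /dl /F -[ltRHS]lnK ?posrE// ltr_expR ltrNl.
have cf t : 0 < t < 1 -> {for t, continuous f}.
  by move=> t01; exact: (sqrt_profile_continuous mE mp pK t01).
have mf : measurable_fun (`]0, 1[%classic : set R) f.
  apply: open_continuous_measurable_fun; first exact: interval_open.
  by move=> t; rewrite inE/= in_itv/=; exact: cf.
have mfS (A : set R) : measurable A -> A `<=` `]0, 1[%classic -> measurable_fun A (EFin \o f).
  move=> mA A01; apply/measurable_EFinP.
  exact: measurable_funS mf.
have cF x : F y @[y --> x] --> F x.
  apply: (continuous_comp (f := -%R)); first exact: opp_continuous.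
  exact: continuous_expR.
have cNF x : - F y @[y --> x] --> - F x by apply: cvgN; exact: cF.
have piece n : (\int[leb]_(t in `[F (s + n%:R)%R, F s]) (f t)%:E <=
    \int[leb]_(S in `[S0, +oo[) (Num.sqrt (L S))%:E)%E.
  have sn : s <= s + n%:R by rewrite lerDl.
  rewrite (@integration_by_substitution_decreasing R F f s (s + n%:R))//.
  - apply: ge0_subset_le_integral.
    + by apply: subset_itv; rewrite bnd_simp// ltW.
    + move=> S /=; rewrite in_itv/= => /andP[sS _].
      by rewrite lee_fin /= expN_derive1 fctE opprK mulr_ge0// ?sqrtr_ge0 ?expR_ge0.
    + by move=> S _; rewrite lee_fin sqrtr_ge0.
    + move=> S /=; rewrite in_itv/= => /andP[sS _].
      rewrite lee_fin expN_derive1 fctE opprK; apply: sqrt_profile_exp.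
      by rewrite (le_trans _ sS)// ltW.
  - by move=> x y _ _ xy; rewrite ltr_expR ltrN2.
  - by rewrite expN_derive1 => x _; exact: cNF.
  - rewrite expN_derive1; apply/cvg_ex; exists (- expR (- s)).
    by apply: cvg_at_right_filter; exact: cNF.
  - rewrite expN_derive1; apply/cvg_ex; exists (- expR (- (s + n%:R))).
    by apply: cvg_at_left_filter; exact: cNF.
  - split; [|exact/cvg_at_right_filter/cF|exact/cvg_at_left_filter/cF].
    move=> x _; apply/derivable1_diffP; apply: differentiable_comp => //.
    exact/derivable1_diffP/derivable_expR.
  - apply: continuous_in_subspaceT => t; rewrite inE/= in_itv/= => /andP[Ft tF].
    apply: cf; rewrite (lt_le_trans (expR_gt0 _) Ft)/= (le_lt_trans tF)//.
    by rewrite /F -expR0 ltr_expR oppr_lt0.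
pose A n : set (measurableTypeR R) := `[F (s + n%:R), F s]%classic.
have E0 : \bigcup_n A n = `]0, dl]%classic.
  apply/seteqP; split=> t.
    move=> [n _]; rewrite /A /= !in_itv/= => /andP[Ft ->]; rewrite andbT.
    exact: lt_le_trans (expR_gt0 _) Ft.
  rewrite /= in_itv/= => /andP[t0 tdl].
  exists (Num.truncn (- ln t)).+1 => //=; rewrite /A /= in_itv/= tdl andbT.
  rewrite -[leRHS]lnK ?posrE// ler_expR lerNl.
  by rewrite (le_trans (ltW (truncnS_gt _)))// lerDr ltW.
have ndA n m : (n <= m)%N -> A n `<=` A m.
  by move=> nm; apply: subset_itvr; rewrite bnd_simp ler_expR lerN2 lerD2l ler_nat.
have mA n : measurable (A n) by exact: measurable_itv.
have mfA n : measurable_fun (A n) (EFin \o f).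
  apply: mfS; first exact: measurable_itv.
  move=> t; rewrite /A /= !in_itv/= => /andP[Ft tF].
  rewrite (lt_le_trans (expR_gt0 _) Ft)/= (le_lt_trans tF)//.
  exact: lt_trans eps1.
have near0 : (\int[leb]_(t in `]0%R, dl]) (f t)%:E < +oo)%E.
  apply: le_lt_trans intL; rewrite -E0.
  have := @ge0_nondecreasing_set_cvg_integral _ (measurableTypeR R) R A
    (EFin \o f) leb.
  move=> H; rewrite -(cvg_lim (@ereal_hausdorff R) (H _ _ _ _))//.
  - apply: lime_le; last exact: nearW.
    apply: ereal_nondecreasing_is_cvgn => n m nm.
    apply: ge0_subset_le_integral; first exact: ndA.
    + by move=> t _; rewrite lee_fin sqrtr_ge0.
    + by move=> t _; rewrite lee_fin sqrtr_ge0.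
    + by [].
  - by move=> n m nm; rewrite subsetEset; exact: ndA.
  - by move=> n t _; rewrite lee_fin sqrtr_ge0.
pose J0 : set (measurableTypeR R) := `]0, dl]%classic.
have mJ0 : measurable J0 by exact: measurable_itv.
pose J : set (measurableTypeR R) := `]dl, eps[%classic.
have mJ : measurable J by exact: measurable_itv.
have far : (\int[leb]_(t in `]dl, eps[) (f t)%:E < +oo)%E.
  apply: (@le_lt_trans _ _ (\int[leb]_(t in `]dl, eps[) (f dl)%:E)%E).
    apply: ge0_subset_le_integral => //.
    + by move=> t _; rewrite lee_fin sqrtr_ge0.
    + by move=> t _; rewrite lee_fin sqrtr_ge0.
    + move=> t /=; rewrite in_itv/= => /andP[dt te].
      rewrite lee_fin ler_wsqrtr// (profile_nonincreasing mu mE mp pK)// ltW//.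
      exact: lt_trans eps1.
  rewrite [ltLHS](integral_cst leb mJ (f dl)%:E).
  by rewrite [X in (_ * X)%E]lebesgue_measure_itv/= lte_fin dle -EFinD -EFinM ltry.
have JE : `]0, eps[%classic = J0 `|` J.
  by rewrite /J0 /J -itv_bndbnd_setU// bnd_simp// ltW.
rewrite /sqrt_integrable JE.
rewrite (ge0_integral_setU leb mJ0 mJ); first exact: lte_add_pinfty.
- apply: mfS; first exact: measurableU.
  by rewrite -JE; apply: subset_itvl; rewrite bnd_simp ltW.
- by move=> t _; rewrite lee_fin sqrtr_ge0.
- apply/disj_setPLR => t; rewrite /J0 /J /= !in_itv/= => /andP[_ td].
  by rewrite ltNge td.
Qed.

End LaplaceComparison.

(** * Completions *)

Section Completions.
Context {R : realType} {n : nat}.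
Variables (A : set 'rV[R]_n) (d : 'rV[R]_n -> 'rV[R]_n -> \bar R).
Variables (X : metricType R) (i : 'rV[R]_n -> X).
Hypothesis Xi : is_completion A d i.

Lemma completion_approx (xi : X) : exists s : nat -> 'rV[R]_n,
  (forall m, A (s m)) /\ i (s m) @[m --> \oo] --> xi.
Proof.
have [_ _ dA] := Xi.
have /choice[s sP] (m : nat) : exists p, A p /\ mdist xi (i p) < m.+1%:R^-1.
  have nb : nbhs xi (ball xi m.+1%:R^-1) by apply: nbhsx_ballx.
  have [|q [qi [p Ap pq]]] := dA _ _ (@open_interior _ (ball xi m.+1%:R^-1)).
    by exists xi; exact: nb.
  by exists p; split=> //; have := interior_subset qi; rewrite ballEmdist pq.
exists s; split=> [m|]; first by have [] := sP m.
apply/metricType_numDomainType.cvgrPdist_lt => e e0; near=> m.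
have [_ /lt_trans] := sP m; apply.
by near: m; exact: near_infty_natSinv_lt (PosNum e0).
Unshelve. all: by end_near. Qed.

Lemma continuous_extension_unique (f : 'rV[R]_n -> R) (h1 h2 : X -> R) :
  continuous_extension A i f h1 -> continuous_extension A i f h2 -> h1 = h2.
Proof.
move=> [ch1 h1f] [ch2 h2f]; apply/funext => xi.
have [s [As si]] := completion_approx xi.
have c1 : h1 (i (s m)) @[m --> \oo] --> h1 xi.
  exact: (cvg_comp _ _ si (ch1 xi)).
have c2 : h2 (i (s m)) @[m --> \oo] --> h2 xi.
  exact: (cvg_comp _ _ si (ch2 xi)).
have E : (fun m => h1 (i (s m))) = (fun m => h2 (i (s m))).
  by apply/funext => m; rewrite h1f ?h2f.
by rewrite E in c1; exact: cvg_unique c1 c2.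
Qed.

(* McShane's extension *)
Lemma lipschitz_continuous_extension (f : 'rV[R]_n -> R) (L : R) : 0 <= L ->
  (forall p q, A p -> A q -> (`|f p - f q|%:E <= L%:E * d p q)%E) ->
  exists! h : X -> R, continuous_extension A i f h.
Proof.
move=> L0 fL; have [_ di _] := Xi.
have fLi p q : A p -> A q -> `|f p - f q| <= L * mdist (i p) (i q).
  by move=> Ap Aq; rewrite -lee_fin EFinM di//; exact: fL.
suff [h hP] : exists h, continuous_extension A i f h.
  by exists h; split=> // h'; exact: continuous_extension_unique.
(* The vector 0 need not belong to [A]: [i 0] merely shows that [X] is inhabited, so that density
   produces a point of [A]. *)
have [s [As _]] := completion_approx (i 0).
pose p0 := s 0%N; have Ap0 : A p0 by exact: As.
pose S xi := [set f p + L * mdist (i p) xi | p in A].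
pose h xi := inf (S xi).
have S0 xi : S xi !=set0 by exists (f p0 + L * mdist (i p0) xi), p0.
have Slb xi : has_lbound (S xi).
  exists (f p0 - L * mdist (i p0) xi) => _ [p Ap <-].
  have := fLi _ _ Ap0 Ap; have := metric_triangle (i p0) xi (i p).
  move=> /(ler_wpM2l L0); rewrite mulrDr (metric_sym xi (i p)).
  by have := ler_norm (f p0 - f p); lra.
have hlip xi eta : h xi <= h eta + L * mdist xi eta.
  rewrite -lerBlDr; apply: lb_le_inf => // _ [p Ap <-].
  rewrite lerBlDr; apply: (@le_trans _ _ (f p + L * mdist (i p) xi)).
    by apply: ge_inf => //; exists p.
  rewrite -addrA lerD2l -mulrDr ler_wpM2l// (metric_sym xi eta).
  exact: metric_triangle.
have hdist xi eta : `|h xi - h eta| <= L * mdist xi eta.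
  rewrite ler_norml; apply/andP; split.
    by have := hlip eta xi; rewrite (metric_sym eta xi); lra.
  by have := hlip xi eta; lra.
exists h; split=> [xi|p Ap].
  apply/cvgrPdist_lt => e e0.
  have d0 : 0 < e / (L + 1) by rewrite divr_gt0// ltr_wpDl.
  have : \forall eta \near xi, ball xi (e / (L + 1)) eta by exact: nbhsx_ballx.
  apply: filterS => eta; rewrite ballEmdist /= => xe.
  apply: le_lt_trans (hdist _ _) _; apply: (@le_lt_trans _ _ ((L + 1) * mdist xi eta)).
    by rewrite ler_wpM2r ?lerDl// mdist_ge0.
  by rewrite mulrC -ltr_pdivlMr// ltr_wpDl.
apply/eqP; rewrite eq_le; apply/andP; split.
  by apply: ge_inf => //; exists p => //; rewrite mdistxx mulr0 addr0.
apply: lb_le_inf => // _ [q Aq <-].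
have := fLi _ _ Aq Ap; have := ler_norm (f p - f q); rewrite distrC; lra.
Qed.

End Completions.

(** * The conformal chart *)

Section CurveTools.
Context {R : realType}.

Lemma abs_cont_lipschitz (a b C : R) (h g : R -> R) : 0 <= C ->
  (forall s t, a <= s <= b -> a <= t <= b -> `|g t - g s| <= C * `|h t - h s|) ->
  abs_cont a b h -> abs_cont a b g.
Proof.
move=> C0 gh ach e e0.
have C1 : 0 < C + 1 by rewrite ltr_wpDl.
have [d d0 hd] := ach _ (divr_gt0 e0 C1); exists d => // T P s t st sd.
apply: (@le_lt_trans _ _ ((C + 1) * \sum_(i | P i) `|h (t i) - h (s i)|)).
  rewrite mulr_sumr; apply: ler_sum => i Pi; have [as_ sti tb] := st.1 i Pi.
  apply: le_trans (gh _ _ _ _) _; rewrite ?as_ ?tb ?(le_trans sti)// ?(le_trans as_)//.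
  by rewrite ler_wpM2r// lerDl.
by rewrite mulrC -ltr_pdivlMr//; exact: hd.
Qed.

Lemma abs_cont_min (a b : R) h : a <= b -> abs_cont a b h ->
  exists2 c, a <= c <= b & forall t, a <= t <= b -> h c <= h t.
Proof.
move=> ab ach; have [] := EVT_min (f := h) ab.
  apply/subspace_continuousP => x /=; rewrite in_itv/= => xab.
  apply/cvgrPdist_lt => e e0; have [d d0 hd] := abs_cont_dist ach e0.
  rewrite near_withinE.
  have : \forall t \near x, `|x - t| < d by exact: (nbhsx_ballx x d d0).
  apply: filterS => t xt; rewrite /= in_itv/= => tab; exact: hd.
move=> c; rewrite in_itv/= => cab cmin; by exists c.
Qed.

Lemma differential_coord n (p v : 'rV[R]_n) j :
  'd (fun q : 'rV[R]_n => q 0 j) p v = v 0 j.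
Proof.
rewrite -(deriveE v (differentiable_coord p 0 j)).
have := @derive_mx R 'rV[R]_n 1 n id p v (@derivable_id _ _ p v).
by rewrite derive_id => /matrixP/(_ 0 j); rewrite mxE.
Qed.

Lemma differential_comp_coord n (f : R -> R) (df : R) (p : 'rV[R]_n) j :
  is_derive (p 0 j) 1 f df ->
  differentiable (fun q : 'rV[R]_n => f (q 0 j)) p /\
  forall v, 'd (fun q : 'rV[R]_n => f (q 0 j)) p v = df * v 0 j.
Proof.
move=> [ex_df df_val].
have dc := differentiable_coord p 0 j.
have df' : differentiable f (p 0 j) by exact/derivable1_diffP.
split; first exact: (differentiable_comp dc df').
move=> v.
have := diff_comp dc df'; rewrite /comp => ->/=.
rewrite differential_coord -[v 0 j in LHS]mulr1 -[v 0 j * 1]/(v 0 j *: (1 : R)).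
by rewrite linearZ/= -deriveE// df_val mulrC.
Qed.

End CurveTools.

Section PrimitiveAlongCurve.
Context d (T : measurableType d) (R : realType).
Variables (mu : {finite_measure set T -> \bar R}) (E : set T) (p : T -> R) (K : R).
Hypothesis mE : measurable E.
Hypothesis mp : measurable_fun E p.
Hypothesis pK : forall a, E a -> 0 <= p a <= K.
Variable eps : R.
Hypothesis eps_lt1 : eps < 1.

Let M (t : R) := \int[mu]_(a in E) t `^ (- p a).
Hypothesis intM : sqrt_integrable `]0, eps[ M.

(** The minimum [h c] over the compact interval is positive, and on values at or above it the
    primitive is Lipschitz with constant [sqrt (M (h c))]. *)
Lemma abs_cont_sqrt_primitive (h : R -> R) : abs_cont 0 1 h ->
  (forall t, 0 <= t <= 1 -> 0 < h t < eps) ->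
  abs_cont 0 1 (sqrt_primitive M \o h).
Proof.
move=> ach h01; have [c c01 cmin] := abs_cont_min ler01 ach.
have /andP[hc0 hce] := h01 _ c01.
apply: (abs_cont_lipschitz (C := Num.sqrt (M (h c))) _ _ ach); first exact: sqrtr_ge0.
have main x y : h c <= x -> x <= y -> y < eps ->
    `|sqrt_primitive M y - sqrt_primitive M x| <= Num.sqrt (M (h c)) * `|y - x|.
  move=> cx xy ye; have x0 := lt_le_trans hc0 cx.
  have /andP[lo hi] := sqrt_primitiveB mE mp pK eps_lt1 intM x0 xy ye.
  rewrite !ger0_norm ?subr_ge0//; last first.
    by rewrite -subr_ge0 (le_trans _ lo)// mulr_ge0 ?sqrtr_ge0 ?subr_ge0.
  apply: le_trans hi _; rewrite ler_wpM2r ?subr_ge0// ler_wsqrtr//.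
  apply: (profile_nonincreasing mu mE mp pK) => //.
  by rewrite (le_trans xy)// ltW// (lt_trans ye).
move=> s t s01 t01; have /andP[_ hs] := h01 _ s01; have /andP[_ ht] := h01 _ t01.
have [st|/ltW ts] := leP (h s) (h t); first exact: main (cmin _ s01) st ht.
by rewrite /= distrC (distrC (h t)); exact: main (cmin _ t01) ts hs.
Qed.

End PrimitiveAlongCurve.

Lemma powRN_ge1 (R : realType) (eps t s : R) : eps < 1 -> 0 < t < eps -> 0 <= s ->
  1 <= t `^ (- s).
Proof.
move=> eps1 /andP[t0 te] s0; rewrite -[leLHS](powRr0 t).
by apply: ger_powR; rewrite ?oppr_le0// t0 ltW// (lt_trans te).
Qed.

Section ConformalChart.
Context (R : realType) (k : nat).
Variables (V : set 'rV[R]_k) (eps : R) (g0 : 'rV[R]_(2 + k) -> 'M[R]_(2 + k)).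
Variables (c0 C0 : R) (mu : {finite_measure set (exponents R) -> \bar R}).
Variables (u : R * R -> 'rV[R]_(2 + k) -> R) (cu Cu : R).
Variables (z0 : 'rV[R]_k) (r : R).
Hypotheses (eps_gt0 : 0 < eps) (eps_lt1 : eps < 1) (c0_gt0 : 0 < c0).
Hypothesis g0_bounds : forall p v, chart eps V p ->
  c0 * qform 1%:M v <= qform (g0 p) v <= C0 * qform 1%:M v.
Hypothesis supp_compact : compact (msupport mu).
Hypothesis supp_ge0 : forall a, msupport mu a -> 0 <= a.1 /\ 0 <= a.2.
Hypothesis u_gt0 : forall a p, msupport mu a -> chart_int eps V p -> 0 < u a p.
Hypothesis cu_gt0 : 0 < cu.
Hypothesis u_bounds : {ae mu, forall a, msupport mu a ->
  forall p, chart_int eps V p -> cu <= u a p <= Cu}.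
Hypothesis F_gt0 : forall p, chart_int eps V p -> 0 < conformal_factor mu u p.
Hypothesis r_gt0 : 0 < r.
Hypothesis B_sub : closure (eball z0 r) `<=` V.

Let E : set (exponents R) := msupport mu.
Let F := conformal_factor mu u.
Let UB := chart_int eps (eball z0 r).
Let gmu := fun p => F p *: g0 p.
Let dmu := intrinsic_dist UB gmu.
Let L := (Num.sqrt (c0 * cu))^-1.
Let m := fine (mu E).

Let mE : measurable E := msupport_measurable supp_compact.

Let L_gt0 : 0 < L.
Proof. by rewrite invr_gt0 sqrtr_gt0 mulr_gt0. Qed.

Let chart_intS q : UB q -> chart_int eps V q.
Proof. by case=> x y z; split=> //; apply/B_sub/subset_closure. Qed.

Let chart_intW q : chart_int eps V q -> chart eps V q.
Proof.
by case=> /andP[x ex] /andP[y ey] z; split=> //; rewrite ?ex ?ey andbT ltW.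
Qed.

Let weight (q : 'rV[R]_(2 + k)) (a : R * R) :=
  cx q `^ (- a.1) * cy q `^ (- a.2).

(** The minorant [w] stands for the constant 1, which gives the mass bound behind the coordinates,
    or for a single power of one coordinate, which gives a marginal profile. *)
Let conformal_factor_ge (w : exponents R -> R) q : chart_int eps V q ->
  mu.-integrable E (EFin \o w) -> (forall a, E a -> 0 <= w a <= weight q a) ->
  cu * \int[mu]_(a in E) w a <= F q.
Proof.
move=> Vq intw w_itv; have := F_gt0 Vq; rewrite /F /conformal_factor /Rintegral.
set I := (X in fine X) => I_gt0.
have u0 a : E a -> (0 <= (u a q * cx q `^ (- a.1) * cy q `^ (- a.2))%:E)%E.
  by move=> Ea; rewrite lee_fin !mulr_ge0 ?powR_ge0// ltW// u_gt0.
have I0 : (0 <= I)%E by apply: integral_ge0.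
(* Were the extended integral infinite, its real value would be 0 by convention, against the
   positivity of [F]. *)
have Ifin : I \is a fin_num.
  by rewrite ge0_fin_numE// ltey; apply: contraTneq I_gt0 => ->; rewrite ltxx.
have [N [mN N0 bN]] := u_bounds.
have w0 a : E a -> 0 <= w a by move=> /w_itv/andP[].
have mw : measurable_fun E (EFin \o w) by have /integrableP[] := intw.
rewrite -lee_fin (fineK Ifin) EFinM fineK; last exact: integrable_fin_num.
rewrite -ge0_integralZl_EFin ?(ltW cu_gt0)//.
rewrite (@ge0_negligible_integral _ _ _ mu _ N)//; last 2 first.
- exact: measurable_funeM.
- by move=> a Ea; rewrite mule_ge0// lee_fin ?w0// ltW.
rewrite /I; apply: ge0_subset_le_integral => //.
- by move=> a [Ea _]; rewrite mule_ge0// lee_fin ?w0// ltW.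
- move=> a [Ea Na]; rewrite -EFinM lee_fin -mulrA.
  have /andP[wa0 wa] := w_itv _ Ea.
  have /andP[ua _] := subsetCl bN Na Ea q Vq.
  by apply: ler_pM => //; exact: ltW.
Qed.

Let center := row_mx (const_mx (eps / 2) : 'rV[R]_2) z0.

Let UB_center : UB center.
Proof.
have e2 : 0 < eps / 2 < eps by rewrite divr_gt0//= gtr_pMr// invf_lt1 ?ltr1n.
rewrite /UB /chart_int /= /cx /cy /cz row_mxKl row_mxKr !mxE; split=> //.
by rewrite /eball /= subrr /enorm qform1E big1 ?sqrtr0// => j _; rewrite mxE expr0n.
Qed.

(** If the support were null, the integral defining [F] would vanish at [center], against the
    positivity of [F]. *)
Lemma msupport_mass_gt0 : 0 < m.
Proof.
have := F_gt0 (chart_intS UB_center); apply: contraTT.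
rewrite -!leNgt => m0; have mu0 : mu E = 0%E.
  have : mu E \is a fin_num by exact: fin_num_measure.
  move=> /fineK <-; congr EFin; apply/eqP.
  by rewrite eq_le m0 fine_ge0.
rewrite /F /conformal_factor /Rintegral.
suff -> : (\int[mu]_(a in msupport mu)
  (u a center * cx center `^ (- a.1) * cy center `^ (- a.2))%:E = 0)%E by [].
have u0 a : E a -> (0 <= (u a center * cx center `^ (- a.1) * cy center `^ (- a.2))%:E)%E.
  move=> Ea; rewrite lee_fin !mulr_ge0 ?powR_ge0// ltW// u_gt0//.
  exact: chart_intS.
apply/eqP; rewrite eq_le; apply/andP; split; last exact: integral_ge0.
(* The integrand is dominated by the constant [+oo], whose integral over a null set is 0. *)
apply: (@le_trans _ _ (\int[mu]_(a in E) +oo)%E).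
  by apply: ge0_subset_le_integral => // a _; rewrite leey.
by rewrite integral_cst// [X in (_ * X)%E]mu0 mule0.
Qed.

(** Origin of the constant [L]: after squaring, this is the product of [cu * w <= F q] and
    [c0 * v_j ^+ 2 <= qform (g0 q) v]. *)
Let metric_norm_ge w q (v : 'rV[R]_(2 + k)) j : chart_int eps V q -> 0 <= w -> cu * w <= F q ->
  Num.sqrt w * `|v 0 j| <= L * metric_norm gmu q v.
Proof.
move=> Vq w0 wF; rewrite /L mulrC ler_pdivlMl ?sqrtr_gt0 ?mulr_gt0//.
rewrite -sqrtr_sqr [X in _ * X]mulrC -!sqrtrM ?mulr_ge0 ?(ltW c0_gt0) ?(ltW cu_gt0)//.
apply: ler_wsqrtr.
have -> : qform (gmu q) v = F q * qform (g0 q) v.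
  by rewrite /qform /gmu -scalemxAr -scalemxAl mxE.
have /andP[g0v _] := g0_bounds v (chart_intW Vq).
rewrite (_ : c0 * cu * _ = (cu * w) * (c0 * v 0 j ^+ 2)); last by ring.
apply: ler_pM => //.
- by rewrite mulr_ge0// ltW.
- by rewrite mulr_ge0 ?sqr_ge0// ltW.
by apply: le_trans g0v; rewrite ler_wpM2l ?sqr_coord_le ?(ltW c0_gt0).
Qed.

Let conformal_factor_ge_mass q : chart_int eps V q -> cu * m <= F q.
Proof.
move=> Vq; have [cxq cyq _] := Vq.
rewrite -[m]mul1r -(Rintegral_cst mu mE); apply: conformal_factor_ge => //.
  exact: finite_measure_integrable_cst.
move=> a Ea; have [a1 a2] := supp_ge0 Ea; rewrite ler01 /weight /=.
by rewrite -[leLHS]mulr1; apply: ler_pM => //; exact: (powRN_ge1 eps_lt1).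
Qed.

(** Taking [w = m] in the norm estimate costs the factor [1 / sqrt m]. All coordinates are covered,
    including those along the stratum, as the full Euclidean limit is required. *)
Let coord_lipschitz (j : 'I_(2 + k)) q q' : UB q -> UB q' ->
  (`|q 0 j - q' 0 j|%:E <= (L / Num.sqrt m)%:E * dmu q q')%E.
Proof.
move=> Uq Uq'; have sm0 : 0 < Num.sqrt m by rewrite sqrtr_gt0 msupport_mass_gt0.
apply: (@le_intrinsic_dist R _ _ _ (fun x : 'rV[R]_(2 + k) => x 0 j)).
- by rewrite divr_gt0.
- by move=> c [acc _ _ _]; exact: abs_continuous_coord.
- move=> x Ux; split; first exact: differentiable_coord.
  move=> v; rewrite differential_coord mulrAC ler_pdivlMr// mulrC.
  apply: metric_norm_ge; [exact: chart_intS|exact/ltW/msupport_mass_gt0|].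
  exact/conformal_factor_ge_mass/chart_intS.
Qed.

(** * One marginal primitive and its coordinate, for either face *)

Section Coordinate.
Variables (p : exponents R -> R) (j : 'I_(2 + k)) (K : R).
Hypothesis mp : measurable_fun E p.
Hypothesis pK : forall a, E a -> 0 <= p a <= K.
Hypothesis le_weight : forall q a, chart_int eps V q -> E a ->
  q 0 j `^ (- p a) <= weight q a.
Hypothesis coord_itv : forall q W, chart_int eps W q -> 0 < q 0 j < eps.

Let M (t : R) := \int[mu]_(a in E) t `^ (- p a).
Hypothesis intM : sqrt_integrable `]0, eps[ M.
Let Xi (q : 'rV[R]_(2 + k)) := sqrt_primitive M (q 0 j).

Lemma Xi_differential_le q : UB q -> differentiable Xi q /\
  forall v, `|'d Xi q v| <= L * metric_norm gmu q v.
Proof.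
move=> Uq; have Vq := chart_intS Uq.
have /andP[q0 qe] := coord_itv Vq.
have [dXi dXiE] := differential_comp_coord
  (is_derive_sqrt_primitive mE mp pK eps_lt1 intM (coord_itv Vq)).
split=> // v; rewrite dXiE normrM ger0_norm ?sqrtr_ge0//.
apply: metric_norm_ge => //; first exact: profile_ge0.
apply: conformal_factor_ge => //.
  by apply: (profile_integrable mu mE mp pK); rewrite // ltW// (lt_trans qe).
by move=> a Ea; rewrite powR_ge0/=; exact: le_weight.
Qed.

Lemma Xi_lipschitz q q' : UB q -> UB q' ->
  (`|Xi q - Xi q'|%:E <= L%:E * dmu q q')%E.
Proof.
move=> Uq Uq'; apply: le_intrinsic_dist => //; last exact: Xi_differential_le.
move=> c [acc cU _ _].
apply: (abs_cont_sqrt_primitive mE mp pK eps_lt1 intM).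
  exact: abs_continuous_coord.
by move=> t /cU; exact: coord_itv.
Qed.

Variables (X : metricType R) (i : 'rV[R]_(2 + k) -> X) (h : X -> R).
Hypothesis hXi : continuous_extension UB i Xi h.

(** Formulated along an approximating sequence, so that the conditions for both coordinates can be
    read off one and the same sequence and compared with its Euclidean limit. *)
Lemma Xi_extension_eq0 (s : nat -> 'rV[R]_(2 + k)) (xi : X) :
  (forall l, UB (s l)) -> i (s l) @[l --> \oo] --> xi ->
  h xi = 0 <-> s l 0 j @[l --> \oo] --> (0 : R).
Proof.
move=> Us si; have [ch hE] := hXi.
have XiE l : h (i (s l)) = Xi (s l) by apply: hE.
have Xih : Xi (s l) @[l --> \oo] --> h xi.
  have := cvg_comp _ _ si (ch xi); apply: cvg_trans.
  by apply: near_eq_cvg; apply: nearW => l /=; rewrite XiE.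
have sm0 : 0 < Num.sqrt m by rewrite sqrtr_gt0 msupport_mass_gt0.
split=> [hxi0|s0].
  rewrite hxi0 in Xih.
  have Xi0 : (Num.sqrt m)^-1 * Xi (s l) @[l --> \oo] --> (0 : R).
    by rewrite -[X in _ --> X](mulr0 (Num.sqrt m)^-1); exact: cvgMr.
  apply: (@squeeze_cvgr _ _ _ _ (cst 0) _ _ _ _ _ Xi0); last exact: cvg_cst.
  apply: nearW => l /=; have /andP[sl0 sle] := coord_itv (Us l).
  rewrite ltW//= ler_pdivlMl//.
  exact: (sqrt_primitive_ge mE mp pK eps_lt1 intM).
have Xi0 : Xi (s l) @[l --> \oo] --> (0 : R).
  have := sqrt_primitive_cvg0 mE mp pK eps_gt0 eps_lt1 intM.
  move=> /cvgrPdist_lt H; apply/cvgrPdist_lt => e e0.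
  (* The limit of the primitive at 0 is one-sided; it applies along the sequence because the
     coordinates there are positive. *)
  have := H _ e0; rewrite near_withinE => He.
  have {}He : \forall l \near \oo, 0 < s l 0 j -> `|0 - Xi (s l)| < e.
    exact: s0 _ He.
  apply: filterS He => l; apply.
  by have /andP[] := coord_itv (Us l).
exact: cvg_unique Xih Xi0.
Qed.

End Coordinate.

Lemma euclidean_limit_exists (X : metricType R) (i : 'rV[R]_(2 + k) -> X) (xi : X) :
  is_completion UB dmu i -> exists p, euclidean_limit UB i xi p.
Proof.
move=> iX; have Lm : 0 <= L / Num.sqrt m by rewrite divr_ge0 ?sqrtr_ge0 ?ltW.
have /choice[h hP] (j : 'I_(2 + k)) : exists h : X -> R,
    continuous_extension UB i (fun q => q 0 j) h.
  have [h [hP _]] := lipschitz_continuous_extension iX Lm (coord_lipschitz j).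
  by exists h.
(* The candidate collects the extended coordinates at [xi], hence does not depend on the
   approximating sequence. *)
exists (\row_j h j xi) => s Us si.
apply/cvgrPdist_le => /= e e0; near=> l.
rewrite [leLHS]/Num.Def.normr/= mx_normrE (bigmax_le _ (ltW e0))//= => -[i0 j] _.
rewrite !mxE /= ord1; move: j; near: l; apply: filter_forall => j.
have [ch hE] := hP j.
have := cvg_comp _ _ si (ch xi) => /cvgrPdist_le/(_ _ e0).
by apply: filterS => l /=; rewrite hE.
Unshelve. all: by end_near. Qed.

End ConformalChart.

Theorem proposition7p3 (R : realType) (k : nat) (V : set 'rV[R]_k) (eps : R)
  (g0 : 'rV[R]_(2 + k) -> 'M[R]_(2 + k)) (c0 C0 : R)
  (mu : {finite_measure set (exponents R) -> \bar R})
  (u : R * R -> 'rV[R]_(2 + k) -> R) (cu Cu : R)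
  (z0 : 'rV[R]_k) (r : R)
  (V_open : open V) (eps_gt0 : 0 < eps) (eps_lt1 : eps < 1)
  (g0_metric : riemannian_metric (chart eps V) g0)
  (c0_gt0 : 0 < c0) (c0_le_C0 : c0 <= C0)
  (g0_bounds : forall p v, chart eps V p ->
     c0 * qform 1%:M v <= qform (g0 p) v <= C0 * qform 1%:M v)
  (mu_neq0 : mu setT != 0%E)
  (supp_compact : compact (msupport mu))
  (supp_ge0 : forall a, msupport mu a -> 0 <= a.1 /\ 0 <= a.2)
  (u_gt0 : forall a p, msupport mu a -> chart_int eps V p -> 0 < u a p)
  (u_meas : jointly_measurable (msupport mu) (chart_int eps V) u)
  (cu_gt0 : 0 < cu) (cu_le_Cu : cu <= Cu)
  (u_bounds : {ae mu, forall a, msupport mu a ->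
     forall p, chart_int eps V p -> cu <= u a p <= Cu})
  (F_cont : {within chart_int eps V, continuous (conformal_factor mu u)})
  (F_gt0 : forall p, chart_int eps V p -> 0 < conformal_factor mu u p)
  (r_gt0 : 0 < r)
  (B_compact : compact (closure (eball z0 r)))
  (B_sub : closure (eball z0 r) `<=` V) :
  let UB := chart_int eps (eball z0 r) in
  let gmu := fun p => conformal_factor mu u p *: g0 p in
  let dmu := intrinsic_dist UB gmu in
  let Xi_x := fun p : 'rV[R]_(2 + k) => sqrt_primitive (profile_x mu) (cx p) in
  let Xi_y := fun p : 'rV[R]_(2 + k) => sqrt_primitive (profile_y mu) (cy p) in
  let marginals_integrable :=
    sqrt_integrable `]0, eps[ (profile_x mu) /\
    sqrt_integrable `]0, eps[ (profile_y mu) in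
  let L := (Num.sqrt (c0 * cu))^-1 in
  (marginals_integrable ->
     [/\ forall p, UB p ->
           [/\ differentiable Xi_x p, differentiable Xi_y p,
               forall v, `|'d Xi_x p v| <= L * metric_norm gmu p v &
               forall v, `|'d Xi_y p v| <= L * metric_norm gmu p v],
         forall p q, UB p -> UB q ->
           (`|Xi_x p - Xi_x q|%:E <= L%:E * dmu p q)%E /\
           (`|Xi_y p - Xi_y q|%:E <= L%:E * dmu p q)%E &
         forall (X : metricType R) (i : 'rV[R]_(2 + k) -> X),
           is_completion UB dmu i ->
           (exists! hx : X -> R, continuous_extension UB i Xi_x hx) /\
           (exists! hy : X -> R, continuous_extension UB i Xi_y hy)]) /\
  (max_weight mu <= 2 ->
   (exists2 S0 : R, 0 <= S0 & sqrt_integrable `[S0, +oo[ (laplace_profile mu)) ->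
     marginals_integrable /\
     forall (X : metricType R) (i : 'rV[R]_(2 + k) -> X),
       is_completion UB dmu i ->
       forall hx hy : X -> R,
         continuous_extension UB i Xi_x hx ->
         continuous_extension UB i Xi_y hy ->
         forall xi : X,
           (hx xi = 0 /\ hy xi = 0) <-> over_corner UB i xi).

Proof.
move=> UB gmu dmu Xi_x Xi_y marginals L.
have mE := msupport_measurable supp_compact.
have [K EK] := msupport_bounded supp_compact.
pose jx : 'I_(2 + k) := lshift k 0; pose jy : 'I_(2 + k) := lshift k 1.
have cxE (q : 'rV[R]_(2 + k)) : cx q = q 0 jx by rewrite /cx mxE.
have cyE (q : 'rV[R]_(2 + k)) : cy q = q 0 jy by rewrite /cy mxE.
have Xi_xE : Xi_x = fun q => sqrt_primitive (profile_x mu) (q 0 jx).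
  by apply/funext => q; rewrite /Xi_x cxE.
have Xi_yE : Xi_y = fun q => sqrt_primitive (profile_y mu) (q 0 jy).
  by apply/funext => q; rewrite /Xi_y cyE.
have m1 : measurable_fun (msupport mu : set (exponents R)) (fun a => a.1 : R).
  by apply: measurable_funTS; exact: measurable_fst.
have m2 : measurable_fun (msupport mu : set (exponents R)) (fun a => a.2 : R).
  by apply: measurable_funTS; exact: measurable_snd.
have K1 a : msupport mu a -> 0 <= a.1 <= K.
  by move=> Ea; rewrite (supp_ge0 _ Ea).1 (EK _ Ea).1.
have K2 a : msupport mu a -> 0 <= a.2 <= K.
  by move=> Ea; rewrite (supp_ge0 _ Ea).2 (EK _ Ea).2.
have itv_x q W : chart_int eps W q -> 0 < q 0 jx < eps by case; rewrite cxE.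
have itv_y q W : chart_int eps W q -> 0 < q 0 jy < eps by case; rewrite cyE.
have weight_x q a : chart_int eps V q -> msupport mu a ->
    q 0 jx `^ (- a.1) <= cx q `^ (- a.1) * cy q `^ (- a.2).
  move=> Vq Ea; rewrite cxE ler_peMr ?powR_ge0// cyE.
  apply: (powRN_ge1 eps_lt1 (itv_y _ _ Vq)); exact: (supp_ge0 _ Ea).2.
have weight_y q a : chart_int eps V q -> msupport mu a ->
    q 0 jy `^ (- a.2) <= cx q `^ (- a.1) * cy q `^ (- a.2).
  move=> Vq Ea; rewrite cyE ler_peMl ?powR_ge0// cxE.
  apply: (powRN_ge1 eps_lt1 (itv_x _ _ Vq)); exact: (supp_ge0 _ Ea).1.
have L0 : 0 <= L by rewrite invr_ge0 sqrtr_ge0.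
split=> [[intx inty]|A2 [S0 S00 intS]].
  have Dx q : UB q -> differentiable Xi_x q /\
      forall v, `|'d Xi_x q v| <= L * metric_norm gmu q v.
    rewrite Xi_xE; exact: (Xi_differential_le eps_lt1 c0_gt0 g0_bounds
      supp_compact u_gt0 cu_gt0 u_bounds F_gt0 B_sub m1 K1 weight_x itv_x intx).
  have Dy q : UB q -> differentiable Xi_y q /\
      forall v, `|'d Xi_y q v| <= L * metric_norm gmu q v.
    rewrite Xi_yE; exact: (Xi_differential_le eps_lt1 c0_gt0 g0_bounds
      supp_compact u_gt0 cu_gt0 u_bounds F_gt0 B_sub m2 K2 weight_y itv_y inty).
  have Lx q q' : UB q -> UB q' -> (`|Xi_x q - Xi_x q'|%:E <= L%:E * dmu q q')%E.
    rewrite Xi_xE; exact: (Xi_lipschitz eps_lt1 c0_gt0 g0_bounds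
      supp_compact u_gt0 cu_gt0 u_bounds F_gt0 B_sub m1 K1 weight_x itv_x intx).
  have Ly q q' : UB q -> UB q' -> (`|Xi_y q - Xi_y q'|%:E <= L%:E * dmu q q')%E.
    rewrite Xi_yE; exact: (Xi_lipschitz eps_lt1 c0_gt0 g0_bounds
      supp_compact u_gt0 cu_gt0 u_bounds F_gt0 B_sub m2 K2 weight_y itv_y inty).
  split.
  - by move=> q Uq; have [? ?] := Dx q Uq; have [? ?] := Dy q Uq.
  - by move=> q q' Uq Uq'; split; [exact: Lx|exact: Ly].
  - move=> X i iX; split.
      exact: (lipschitz_continuous_extension iX L0 Lx).
    exact: (lipschitz_continuous_extension iX L0 Ly).
have EA a : msupport mu a -> a.1 + a.2 <= 2.
  by move=> Ea; apply: le_trans A2; exact: le_max_weight.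
have mq : measurable_fun (msupport mu : set (exponents R))
    (fun a => 2 - a.1 - a.2 : R).
  by apply: measurable_funB => //; apply: measurable_funB.
have q0 a : msupport mu a -> 0 <= 2 - a.1 - a.2.
  by move=> /EA; lra.
have q1 a : msupport mu a -> 2 - a.1 - a.2 <= 2 - a.1.
  by move=> /supp_ge0[_]; lra.
have q2 a : msupport mu a -> 2 - a.1 - a.2 <= 2 - a.2.
  by move=> /supp_ge0[+ _]; lra.
have intx : sqrt_integrable `]0, eps[ (profile_x mu).
  exact: (sqrt_integrable_of_laplace mE m1 mq K1 q0 q1 eps_gt0 eps_lt1 S00 intS).
have inty : sqrt_integrable `]0, eps[ (profile_y mu).
  exact: (sqrt_integrable_of_laplace mE m2 mq K2 q0 q2 eps_gt0 eps_lt1 S00 intS).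
split=> // X i iX hx hy hxE hyE xi.
rewrite Xi_xE in hxE; rewrite Xi_yE in hyE.
have [s [Us si]] := completion_approx iX xi.
have hx0 := Xi_extension_eq0 eps_gt0 eps_lt1 supp_compact u_gt0 F_gt0 r_gt0
  B_sub m1 K1 itv_x intx hxE Us si.
have hy0 := Xi_extension_eq0 eps_gt0 eps_lt1 supp_compact u_gt0 F_gt0 r_gt0
  B_sub m2 K2 itv_y inty hyE Us si.
have coord_lim p j : euclidean_limit UB i xi p -> s l 0 j @[l --> \oo] --> p 0 j.
  move=> limp; apply: (cvg_comp s (fun q : 'rV[R]_(2 + k) => q 0 j) (limp s Us si)).
  exact: (@coord_continuous R 1 (2 + k) 0 j p).
(* Both vanishing conditions are now limits along the single sequence [s]. Forwards, the existing
   Euclidean limit must have these limits as its first two coordinates; backwards, they are read off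
   the given limit. *)
rewrite /over_corner hx0 hy0; split=> [[sx sy]|[p [limp]]].
  have [p limp] := euclidean_limit_exists eps_gt0 eps_lt1 c0_gt0 g0_bounds
    supp_compact supp_ge0 u_gt0 cu_gt0 u_bounds F_gt0 r_gt0 B_sub xi iX.
  exists p; split=> //; rewrite ?cxE ?cyE.
    exact: cvg_unique (coord_lim _ _ limp) sx.
  exact: cvg_unique (coord_lim _ _ limp) sy.
rewrite cxE cyE => px py.
by have := coord_lim p jx limp; have := coord_lim p jy limp; rewrite px py.
Qed.
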